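(* Let $\omega\in\mathbb R$ and $\gamma=2\pi p/q$ with $p,q\in\mathbb N^*$ relatively prime, and denote by $\sigma_{\gamma,\omega}$ the spectrum of $Q_{\gamma,\omega}$. Then $$\sigma_{\gamma,\omega}=\bigcup_{\theta_1,\theta_2\in[0,1]}\sigma(M_{p,q,\omega,\theta_1,\theta_2}),$$ where $M_{p,q,\omega,\theta_1,\theta_2}\in M_{3q}(\mathbb C)$ is the block matrix $$M_{p,q,\omega,\theta_1,\theta_2}=\begin{pmatrix}0_q&M^{13}&M^{15}\\ [M^{13}]^*&0_q&M^{35}\\ [M^{15}]^*&[M^{35}]^*&0_q\end{pmatrix}$$ with $$M^{13}=e^{i(\omega+\frac\pi4\frac pq)}\big(e^{i2\pi\theta_1}K_q+e^{-i\pi\frac pq}e^{i2\pi(\theta_1+\theta_2)}K_qJ_{p,q}\big),$$ $$M^{15}=e^{-i(\omega+\frac\pi4\frac pq)}\big(e^{i2\pi\theta_1}K_q+e^{-i2\pi\theta_2}J_{p,q}^*\big),$$ $$M^{35}=e^{i(\omega+\frac\pi4\frac pq)}\big(e^{-i\pi\frac pq}e^{-2i\pi(\theta_1+\theta_2)}K_q^*J_{p,q}^*+e^{-i2\pi\theta_2}J_{p,q}^*\big).$$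
   Context: $J_{p,q},K_q\in M_q(\mathbb C)$ are $J_{p,q}=\mathrm{diag}(e^{2i\pi(j-1)p/q})_{1\le j\le q}$ and $(K_q)_{ij}=1$ if $j=i+1\pmod q$, $(K_q)_{ij}=0$ otherwise. On $\ell^2(\mathbb Z^2;\mathbb C)$ let $(\tau_1v)_\alpha=v_{\alpha_1-1,\alpha_2}$, $(\tau_2v)_\alpha=e^{i\gamma\alpha_1}v_{\alpha_1,\alpha_2-1}$. Acting on $\ell^2(\mathbb Z^2;\mathbb C^3)$, $$Q_{\gamma,\omega}=\begin{pmatrix}0&e^{i(\omega+\frac\gamma8)}(\tau_1^*+e^{-i\frac\gamma2}\tau_1^*\tau_2)&e^{-i(\omega+\frac\gamma8)}(\tau_1^*+\tau_2^* )\\ e^{-i(\omega+\frac\gamma8)}(\tau_1+e^{-i\frac\gamma2}\tau_1\tau_2^* )&0&e^{i(\omega+\frac\gamma8)}(e^{-i\frac\gamma2}\tau_1\tau_2^*+\tau_2^* )\\ e^{i(\omega+\frac\gamma8)}(\tau_1+\tau_2)&e^{-i(\omega+\frac\gamma8)}(e^{-i\frac\gamma2}\tau_1^*\tau_2+\tau_2)&0\end{pmatrix}.$$ *)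

(* Defs.v *)
From mathcomp Require Import all_boot all_order all_algebra.
From mathcomp Require Import complex.
From mathcomp Require Import mathcomp_extra boolp classical_sets functions.
From mathcomp Require Import set_interval reals ereal esum sequences trigo.
From mathcomp Require Import numfun.
From mathcomp Require Import ring.
Set Implicit Arguments.
Unset Strict Implicit.
Unset Printing Implicit Defensive.

Import Order.TTheory GRing.Theory Num.Theory.
Import ComplexField.Normc.

Local Open Scope classical_set_scope.
Local Open Scope complex_scope.
Local Open Scope ring_scope.

(* The complex exponential e^(ix) of a real x, by Euler's formula. *)
Definition expi (R : realType) (x : R) : R[i] := cos x +i* sin x.

Section SquareSummable.
Variables (R : realType) (n : nat).

Local Notation V := (int * int -> 'cV[R[i]]_n).

Definition sqnorm (v : V) : \bar R :=
  \esum_(a in [set: int * int]) (\sum_(j < n) normc (v a j 0) ^+ 2)%:E.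

Definition l2 : set V := [set v | (sqnorm v < +oo)%E].

(* Junk value outside of [l2]. *)
Definition l2norm (v : V) : R := Num.sqrt (fine (sqnorm v)).

(* A map defined on all functions is viewed as an operator on [l2] through its
   restriction; its values outside of [l2] play no role. *)
Definition bounded_operator (S : V -> V) : Prop :=
  [/\ forall v, l2 v -> l2 (S v),
      forall (c : R[i]) u v, l2 u -> l2 v -> S (c *: u + v) = c *: S u + S v
    & exists C : R, forall v, l2 v -> l2norm (S v) <= C * l2norm v].

Definition resolvent_set (T : V -> V) : set R[i] :=
  [set lambda | exists S, bounded_operator S /\
     forall v, l2 v -> S (T v - lambda *: v) = v /\
                       T (S v) - lambda *: S v = v].

Definition spectrum (T : V -> V) : set R[i] := ~` resolvent_set T.

End SquareSummable.

Section Translations.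
Variable R : realType.

Local Notation F := (int * int -> R[i]).

Definition tau1 : F -> F := fun v a => v (a.1 - 1, a.2).

Definition tau2 (gamma : R) : F -> F :=
  fun v a => expi (gamma * a.1%:~R) * v (a.1, a.2 - 1).

(* The Hilbert space adjoints of [tau1] and [tau2]: see [tau1_adjoint] and
   [tau2_adjoint]. *)
Definition tau1s : F -> F := fun v a => v (a.1 + 1, a.2).

Definition tau2s (gamma : R) : F -> F :=
  fun v a => expi (- (gamma * a.1%:~R)) * v (a.1, a.2 + 1).

Definition rsum (f : int * int -> R) : R :=
  fine (\esum_(a in [set: int * int]) (EFin \o f)^\+ a
        - \esum_(a in [set: int * int]) (EFin \o f)^\- a)%E.

(* Antilinear in the second argument; junk when the series do not converge
   absolutely. *)
Definition inner (v w : F) : R[i] :=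
  rsum (fun a => complex.Re (v a * (w a)^*))
  +i* rsum (fun a => complex.Im (v a * (w a)^*)).

End Translations.

Section Hamiltonian.
Variable R : realType.

Local Notation F := (int * int -> R[i]).

(* The block operator with entries [A i j], acting on functions with values in
   C^n. *)
Definition opmx (n : nat) (A : 'I_n -> 'I_n -> F -> F)
    (v : int * int -> 'cV[R[i]]_n) : int * int -> 'cV[R[i]]_n :=
  fun a => \col_i \sum_(j < n) A i j (fun b => v b j 0) a.

Definition Qentry (gamma omega : R) (i j : nat) : F -> F :=
  let t1 := @tau1 R in let t1' := @tau1s R in
  let t2 := tau2 gamma in let t2' := tau2s gamma in
  let e := expi (omega + gamma / 8) in
  let e' := expi (- (omega + gamma / 8)) in
  let h := expi (- (gamma / 2)) in
  match i, j with
  | 0, 1 => e *: (t1' + h *: (t1' \o t2))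
  | 0, 2 => e' *: (t1' + t2')
  | 1, 0 => e' *: (t1 + h *: (t1 \o t2'))
  | 1, 2 => e *: (h *: (t1 \o t2') + t2')
  | 2, 0 => e *: (t1 + t2)
  | 2, 1 => e' *: (h *: (t1' \o t2) + t2)
  | _, _ => 0
  end.

Definition Q (gamma omega : R) :
    (int * int -> 'cV[R[i]]_3) -> (int * int -> 'cV[R[i]]_3) :=
  opmx (fun i j : 'I_3 => Qentry gamma omega i j).

End Hamiltonian.

Section BlochMatrix.
Variables (R : realType) (p q : nat).

(* Indices start at 0, so that the exponent [j - 1] becomes [j]. *)
Definition Jmx : 'M[R[i]]_q :=
  diag_mx (\row_(j < q) expi (2 * pi * j%:R * p%:R / q%:R)).

Definition Kmx : 'M[R[i]]_q :=
  \matrix_(i < q, j < q) (j == i.+1 %[mod q])%:R.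

Variables omega theta1 theta2 : R.

Let r : R := p%:R / q%:R.

Definition M13 : 'M[R[i]]_q :=
  expi (omega + pi / 4 * r) *:
    (expi (2 * pi * theta1) *: Kmx
     + (expi (- (pi * r)) * expi (2 * pi * (theta1 + theta2))) *:
         (Kmx *m Jmx)).

Definition M15 : 'M[R[i]]_q :=
  expi (- (omega + pi / 4 * r)) *:
    (expi (2 * pi * theta1) *: Kmx
     + expi (- (2 * pi * theta2)) *: (Jmx ^t*)%sesqui).

Definition M35 : 'M[R[i]]_q :=
  expi (omega + pi / 4 * r) *:
    ((expi (- (pi * r)) * expi (- (2 * pi * (theta1 + theta2)))) *:
         ((Kmx ^t*)%sesqui *m (Jmx ^t*)%sesqui)
     + expi (- (2 * pi * theta2)) *: (Jmx ^t*)%sesqui).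

(* The size 3q is written q + (q + q), as required by [block_mx]. *)
Definition blochM : 'M[R[i]]_(q + (q + q)) :=
  block_mx 0 (row_mx M13 M15)
           (col_mx (M13 ^t*)%sesqui (M15 ^t*)%sesqui)
           (block_mx 0 M35 (M35 ^t*)%sesqui 0).

End BlochMatrix.

Section Facts.
Variable R : realType.

Local Notation F := (int * int -> R[i]).

Lemma expiN (x : R) : expi (- x) = (expi x)^*.
Proof. by rewrite /expi cosN sinN. Qed.

Lemma normc_expi (x : R) : normc (expi x) = 1.
Proof. by rewrite /normc /expi cos2Dsin2 sqrtr1. Qed.

Definition shift (s : int * int) (a : int * int) := (a.1 + s.1, a.2 + s.2).

Lemma shift_bij s : set_bij [set: int * int] [set: int * int] (shift s).
Proof.
split=> //; first by move=> -[a b] [c d] _ _ [/addIr-> /addIr->].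
move=> [a b] _; exists (a - s.1, b - s.2) => //.
by rewrite /shift /= !subrK.
Qed.

Lemma rsum_shift s (f : int * int -> R) : rsum f = rsum (f \o shift s).
Proof.
have E (g : int * int -> \bar R) :
    \esum_(a in [set: int * int]) g a =
    \esum_(a in [set: int * int]) g (shift s a).
  exact: reindex_esum (shift_bij s).
rewrite /rsum; congr (fine (_ - _)%E); rewrite E.
  by apply: eq_esum => a _; rewrite !funeposE.
by apply: eq_esum => a _; rewrite !funenegE.
Qed.

Lemma inner_shift s (v w : F) :
  inner v w = inner (v \o shift s) (w \o shift s).
Proof.
by rewrite /inner [X in X +i* _](rsum_shift s) [X in _ +i* X](rsum_shift s).
Qed.

Lemma tau1_adjoint (v w : F) : inner (@tau1 R v) w = inner v (@tau1s R w).
Proof.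
rewrite [LHS](inner_shift (1, 0)).
have -> : tau1 v \o shift (1, 0) = v.
  by apply/funext => -[a b]; rewrite /tau1 /shift /= addrK addr0.
have -> // : w \o shift (1, 0) = tau1s w.
by apply/funext => -[a b]; rewrite /tau1s /shift /= addr0.
Qed.

Lemma tau2_adjoint (gamma : R) (v w : F) :
  inner (tau2 gamma v) w = inner v (tau2s gamma w).
Proof.
rewrite [LHS](inner_shift (0, 1)).
have E a : (tau2 gamma v \o shift (0, 1)) a * ((w \o shift (0, 1)) a)^* =
           v a * (tau2s gamma w a)^*.
  case: a => a b; rewrite /tau2 /tau2s /shift /= addrK addr0 expiN.
  have -> : forall x y : R[i], (x^* * y)^* = x * y^*.
    by move=> x y; rewrite rmorphM; congr (_ * _); exact: conjcK.
  by rewrite mulrCA mulrA.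
by rewrite /inner; congr (rsum _ +i* rsum _); apply/funext => a; rewrite E.
Qed.


Let nrm2 (f : F) : \bar R :=
  \esum_(a in [set: int * int]) (normc (f a) ^+ 2)%:E.

Let bnd (T : F -> F) : Prop :=
  (forall (c : R[i]) u v, T (c *: u + v) = c *: T u + T v) /\
  exists2 C : R, 0 <= C & forall f, (nrm2 (T f) <= C%:E * nrm2 f)%E.

Let S_ge0 f : (0 <= nrm2 f)%E.
Proof. by apply: esum_ge0 => a _; rewrite lee_fin sqr_ge0. Qed.

Let normc_ge0 (z : R[i]) : 0 <= normc z.
Proof. by case: z => x y; rewrite sqrtr_ge0. Qed.

Let sqnormcD (x y : R[i]) :
  normc (x + y) ^+ 2 <= (normc x ^+ 2 + normc x ^+ 2)
                        + (normc y ^+ 2 + normc y ^+ 2).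
Proof.
have : normc (x + y) ^+ 2 <= (normc x + normc y) ^+ 2.
  by rewrite lerXn2r ?nnegrE ?addr_ge0// le_normcD.
move=> /le_trans; apply; rewrite -subr_ge0.
have := sqr_ge0 (normc x - normc y); congr (_ <= _); ring.
Qed.

Let SD (f g : F) : (nrm2 (f + g)%R <= (nrm2 f + nrm2 f) + (nrm2 g + nrm2 g))%E.
Proof.
have N (h : F) a : (0 <= (normc (h a) ^+ 2)%:E)%E.
  by rewrite lee_fin sqr_ge0.
rewrite /nrm2 -!esumD; try by move=> *; rewrite ?adde_ge0.
by apply: le_esum => a _; rewrite -!EFinD lee_fin; exact: sqnormcD.
Qed.

Let bnd0 : bnd 0.
Proof.
split.
  move=> c u v; apply/funext => a.
  exact: esym (etrans (addr0 _) (mulr0 _)).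
by exists 0 => // f; rewrite mul0e /nrm2 esum1// => a _; rewrite normc0 expr0n.
Qed.

Let bndD T U : bnd T -> bnd U -> bnd (T + U).
Proof.
move=> [lT [C C0 hT]] [lU [D D0 hU]]; split.
  move=> c u v; rewrite !addrfctE lT lU scalerDr; exact: addrACA.
exists ((C + C) + (D + D)); first by rewrite !addr_ge0.
move=> f; apply: (le_trans (SD _ _)).
rewrite !EFinD !ge0_muleDl ?lee_fin ?addr_ge0//.
by rewrite !leeD.
Qed.

Let bndZ (x : R) T : bnd T -> bnd (expi x *: T).
Proof.
move=> [lT [C C0 hT]]; split.
  move=> c u v; have E f : (expi x *: T) f = expi x *: T f by [].
  by rewrite !E lT scalerDr !scalerA mulrC.
exists C => // f; apply: le_trans (hT f).
by apply: le_esum => a _; rewrite scalrfctE normcM normc_expi mul1r.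
Qed.

Let bnd_comp T U : bnd T -> bnd U -> bnd (T \o U).
Proof.
move=> [lT [C C0 hT]] [lU [D D0 hU]]; split.
  by move=> c u v /=; rewrite lU lT.
exists (C * D); first exact: mulr_ge0.
move=> f; apply: (le_trans (hT _)); rewrite EFinM -muleA.
by apply: lee_wpmul2l.
Qed.

Let bnd_shift (s : int * int) (T : F -> F) (x : int * int -> R) :
  (forall v a, T v a = expi (x a) * v (shift s a)) -> bnd T.
Proof.
move=> TE; split.
  move=> c u v; apply/funext => a; rewrite !fctE !TE mulrDr; congr (_ + _).
  exact: mulrCA.
exists 1 => // f; rewrite mul1e.
have -> : nrm2 f = \esum_(a in [set: int * int]) (normc (f (shift s a)) ^+ 2)%:E.
  exact: reindex_esum (shift_bij s).
by apply: le_esum => a _; rewrite TE normcM normc_expi mul1r.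
Qed.

Let expi0 : expi (0 : R) = 1.
Proof. by rewrite /expi cos0 sin0. Qed.

Let bnd_tau1 : bnd (@tau1 R).
Proof.
apply: (@bnd_shift (-1, 0) _ (fun=> 0)) => v [a b].
by rewrite expi0 mul1r /shift /= addr0.
Qed.

Let bnd_tau1s : bnd (@tau1s R).
Proof.
apply: (@bnd_shift (1, 0) _ (fun=> 0)) => v [a b].
by rewrite expi0 mul1r /shift /= addr0.
Qed.

Let bnd_tau2 gamma : bnd (@tau2 R gamma).
Proof.
apply: (@bnd_shift (0, -1) _ (fun a => gamma * a.1%:~R)) => v [a b].
by rewrite /shift /= addr0.
Qed.

Let bnd_tau2s gamma : bnd (@tau2s R gamma).
Proof.
apply: (@bnd_shift (0, 1) _ (fun a => - (gamma * a.1%:~R))) => v [a b].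
by rewrite /shift /= addr0.
Qed.

Let bnd_Qentry gamma omega i j : bnd (Qentry gamma omega i j).
Proof.
by case: i => [|[|[|i]]]; case: j => [|[|[|j]]];
  rewrite /Qentry; repeat first [exact: bnd0 | exact: bnd_tau1
    | exact: bnd_tau1s | exact: bnd_tau2 | exact: bnd_tau2s
    | apply: bndZ | apply: bndD | apply: bnd_comp].
Qed.

Let comp n (v : int * int -> 'cV[R[i]]_n) (j : 'I_n) : F := fun a => v a j 0.

Let sqnormE n (v : int * int -> 'cV[R[i]]_n) :
  sqnorm v = (\sum_(j < n) nrm2 (comp v j))%E.
Proof.
rewrite /sqnorm /nrm2 -esum_sum; last by move=> *; rewrite lee_fin sqr_ge0.
by apply: eq_esum => a _; rewrite sumEFin.
Qed.

Let S_sum n : exists2 C : R, 0 <= C & forall P : 'I_n -> F,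
  (nrm2 (fun a => \sum_(j < n) P j a)%R <= C%:E * \sum_(j < n) nrm2 (P j))%E.
Proof.
elim: n => [|n [C C0 hC]].
  exists 0 => // P; rewrite mul0e /nrm2 esum1// => a _.
  by rewrite big_ord0 normc0 expr0n.
exists ((1 + 1) + (C + C)) => [|P]; first by rewrite !addr_ge0.
have -> : (fun a => \sum_(j < n.+1) P j a) =
    P ord0 + (fun a => \sum_(j < n) P (lift ord0 j) a) :> F.
  by apply/funext => a; rewrite big_ord_recl.
apply: (le_trans (SD _ _)); rewrite big_ord_recl.
have {}hC := hC (P \o lift ord0).
have X0 : (0 <= \sum_(j < n) nrm2 (P (lift ord0 j)))%E by exact: sume_ge0.
have C2 : 0 <= C + C by exact: addr_ge0.
rewrite ge0_muleDr//; apply: leeD.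
  rewrite EFinD ge0_muleDl ?lee_fin// EFinD ge0_muleDl ?lee_fin// mul1e.
  by rewrite leeDl// mule_ge0.
rewrite EFinD ge0_muleDl ?lee_fin//.
apply: (@le_trans _ _ ((C + C)%:E * \sum_(j < n) nrm2 (P (lift ord0 j)))%E).
  by rewrite EFinD ge0_muleDl ?lee_fin//; apply: leeD.
by rewrite leeDr// mule_ge0// lee_fin.
Qed.

Let sqnorm_ge0 n (v : int * int -> 'cV[R[i]]_n) : (0 <= sqnorm v)%E.
Proof. by rewrite sqnormE sume_ge0. Qed.

Let sqnorm_opmx n (A : 'I_n -> 'I_n -> F -> F) :
  (forall i j, bnd (A i j)) ->
  exists2 C : R, 0 <= C & forall v, (sqnorm (opmx A v) <= C%:E * sqnorm v)%E.
Proof.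
move=> bA; have [C C0 hC] := S_sum n.
have /choice[D hD] : forall ij : 'I_n * 'I_n, exists c : R,
    0 <= c /\ forall f, (nrm2 (A ij.1 ij.2 f) <= c%:E * nrm2 f)%E.
  by move=> [i j]; have [_ [c c0 hc]] := bA i j; exists c.
exists (\sum_(i < n) C * \sum_(j < n) D (i, j)).
  apply: sumr_ge0 => i _; apply: mulr_ge0 => //; apply: sumr_ge0 => j _.
  by have [] := hD (i, j).
move=> v; rewrite sqnormE -sumEFin ge0_sume_distrl; last first.
  move=> i _; rewrite lee_fin mulr_ge0//; apply: sumr_ge0 => j _.
  by have [] := hD (i, j).
apply: lee_sum => i _.
have -> : comp (opmx A v) i = fun a => \sum_(j < n) A i j (comp v j) a.
  by apply/funext => a; rewrite /comp /opmx mxE.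
apply: (le_trans (hC _)); rewrite EFinM -muleA lee_wpmul2l ?lee_fin//.
rewrite -sumEFin ge0_sume_distrl; last first.
  by move=> j _; have [] := hD (i, j).
apply: lee_sum => j _; have [D0 hDij] := hD (i, j).
apply: (le_trans (hDij _)); rewrite lee_wpmul2l ?lee_fin//.
by rewrite sqnormE (bigD1 j)//= leeDl// sume_ge0.
Qed.

Lemma Q_bounded (gamma omega : R) : bounded_operator (Q gamma omega).
Proof.
have bE (i j : 'I_3) : bnd (Qentry gamma omega i j) by exact: bnd_Qentry.
have [C C0 hC] := sqnorm_opmx bE.
split.
- move=> v; rewrite /l2 /= => v2; apply: (le_lt_trans (hC v)).
  by rewrite lte_mul_pinfty// lee_fin.
- move=> c u v _ _; apply/funext => a; apply/colP => i.
  rewrite !fctE /Q /opmx !mxE mulr_sumr -big_split/=.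
  apply: eq_bigr => j _.
  have [lA _] := bE i j.
  rewrite -[RHS]/((c *: Qentry gamma omega i j (comp u j)
                   + Qentry gamma omega i j (comp v j)) a) -lA.
  by congr (Qentry _ _ _ _ _ a); apply/funext => b; rewrite !fctE !mxE.
- exists (Num.sqrt C) => v v2; rewrite /l2norm -sqrtrM//.
  have fv : sqnorm v \is a fin_num by rewrite ge0_fin_numE.
  rewrite ler_wsqrtr// -lee_fin EFinM fineK//.
    by rewrite fineK//; exact: hC.
  rewrite ge0_fin_numE//; apply: (le_lt_trans (hC v)).
  by rewrite lte_mul_pinfty// lee_fin.
Qed.

End Facts.

(* Main.v *)
Require Import Defs.
From mathcomp Require Import all_boot all_order all_algebra.
From mathcomp Require Import complex.
From mathcomp Require Import finmap mathcomp_extra boolp classical_sets functions.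
From mathcomp Require Import set_interval reals ereal esum sequences trigo.
From mathcomp Require Import cardinality fsbigop topology normedtype derive ring lra zify.
Set Implicit Arguments.
Unset Strict Implicit.
Unset Printing Implicit Defensive.

Import Order.TTheory GRing.Theory Num.Theory.
Import ComplexField.Normc numFieldNormedType.Exports.

Local Open Scope classical_set_scope.
Local Open Scope complex_scope.
Local Open Scope ring_scope.

(** Idea. For theta in [0,1]^2 and y in C^(3q), the Bloch wave with value
    e^(2 i pi (theta1 a1 - theta2 a2)) y_(a1 mod q) at a is a bounded function
    on Z^2, and Q maps it to the Bloch wave of M_theta y. If M_theta y = l y
    with y <> 0, cut this wave off to a box of side N: its squared norm grows
    like N^2, while Q - l only produces terms near the boundary, of squared
    norm O(N); so Q - l has no bounded inverse.

    Conversely, if l is an eigenvalue of no M_theta, then (M_theta - l)^-1 is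
    bounded uniformly in theta by compactness. A discrete Fourier transform
    over N^2 values of theta writes any function on a box as a superposition of
    Bloch waves, isometrically up to a factor. Solving Q u - l u = f mode by
    mode gives a solution on the box with a bound independent of the box, and
    an ultrafilter limit over boxes gives a solution in l^2. The same transform
    bounds Q - l from below on finitely supported functions, which by cutting
    off yields injectivity on l^2. *)

(** * Complex exponentials and sums of roots of unity *)

Section Expi.
Variable R : realType.
Implicit Types x y : R.

Lemma expi0 : expi 0 = 1 :> R[i].
Proof. by rewrite /expi cos0 sin0. Qed.

Lemma expiD x y : expi (x + y) = expi x * expi y.
Proof.
rewrite /expi cosD sinD; apply/eqP; rewrite eq_complex /=.
by apply/andP; split; apply/eqP; ring.
Qed.

Lemma expiMn x n : expi (x *+ n) = expi x ^+ n.
Proof. by elim: n => [|n IH]; rewrite ?expi0 // mulrS exprS expiD IH. Qed.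

Lemma expi2pi : expi (2 * pi) = 1 :> R[i].
Proof. by rewrite /expi mulr_natl cos2pi sin2pi. Qed.

Lemma expi_period (m : int) : expi (2 * pi * m%:~R) = 1 :> R[i].
Proof.
case: m => n; rewrite -?pmulrn.
  by rewrite mulr_natr expiMn expi2pi expr1n.
rewrite NegzE mulrNz mulrN -pmulrn mulr_natr expiN expiMn expi2pi expr1n.
exact: conjC1.
Qed.

(** The real part suffices: 1 - cos(2 pi x) = 2 sin(pi x)^2, and sin is positive on the open
    interval from 0 to pi. *)
Lemma expi_neq1 x : 0 < x < 1 -> expi (2 * pi * x) != 1.
Proof.
move=> /andP[x0 x1]; have p0 := pi_gt0 R; rewrite eq_complex /= negb_and.
have -> : 2 * pi * x = (pi * x) *+ 2 by rewrite mulr2n; ring.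
apply/orP; left; rewrite cos_mulr2n -subr_eq0.
rewrite [X in X != 0](_ : _ = - (sin (pi * x) ^+ 2 *+ 2)); last first.
  by rewrite sin2cos2 !mulr2n; ring.
rewrite oppr_eq0 mulrn_eq0 /= expf_eq0 /= gt_eqF // sin_gt0_pi //.
rewrite mulr_gt0 //= -[X in _ < X]mulr1 ltr_pM2l //.
Qed.

(** A geometric sum of powers of the N-th root of unity z = e^(2 i pi t / N). The bound on t makes z
    differ from 1 unless t = 0, and then (z - 1) times the sum is z^N - 1 = 0. *)
Lemma expi_dft N (t : int) : (`|t| < N)%N ->
  \sum_(k < N) expi (2 * pi * (k%:R * t%:~R / N%:R)) = ((t == 0) * N)%:R :> R[i].
Proof.
move=> tN; have N0 : (N%:R : R) != 0 by rewrite pnatr_eq0; case: N tN.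
pose z : R[i] := expi (2 * pi * (t%:~R / N%:R)).
have zE k : expi (2 * pi * (k%:R * t%:~R / N%:R)) = z ^+ k :> R[i].
  by rewrite -expiMn -mulr_natr; congr expi; ring.
under eq_bigr do rewrite zE.
have [t0|t0] := eqVneq t 0.
  rewrite /z t0 mul0r mulr0 expi0.
  by under eq_bigr do rewrite expr1n; rewrite sumr_const card_ord mul1n.
rewrite mul0n; have zN : z ^+ N = 1.
  rewrite -expiMn -(expi_period t); congr expi.
  by rewrite -mulr_natr; field.
have : (z - 1) * \sum_(k < N) z ^+ k = 0 by rewrite -subrX1 zN subrr.
move=> /eqP; rewrite mulf_eq0 subr_eq0 => /orP[|/eqP //].
suff /negPf -> : z != 1 by [].
have H n : (0 < n < N)%N -> expi (2 * pi * (n%:R / N%:R)) != 1 :> R[i].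
  move=> /andP[n0 nN]; apply: expi_neq1.
  have N1 : 0 < N%:R :> R by rewrite ltr0n (leq_ltn_trans _ nN).
  by apply/andP; split; [apply: divr_gt0 => //; rewrite ltr0n
    | rewrite ltr_pdivrMr // mul1r ltr_nat].
(* For negative t, z is the conjugate of the root attached to -t. *)
move: tN t0; rewrite /z; case: (t) => n /= nN n0.
  by rewrite -pmulrn H // nN andbT lt0n; apply: contra_neq n0 => ->.
rewrite NegzE mulrNz mulNr mulrN expiN -pmulrn.
apply: contra (H n.+1 nN) => /eqP /(congr1 (fun z : R[i] => z^*)).
by rewrite conjCK => ->; rewrite conjC1.
Qed.

End Expi.

(** * Bloch waves *)

Section BlochWaves.
Variables (R : realType) (q : nat) (q_gt0 : (0 < q)%N).

Lemma residue_subproof (n : int) : (`|(n %% q)%Z| < q)%N.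
Proof. by have := @ltz_pmod n q; have := @modz_ge0 n q; lia. Qed.

Definition residue (n : int) : 'I_q := Ordinal (residue_subproof n).

Lemma residueE n : (residue n)%:Z = (n %% q)%Z.
Proof. by rewrite /= gez0_abs // modz_ge0 //; lia. Qed.

Lemma eq_residue (j : 'I_q) n : (j == residue n) = (j%:Z == (n %% q)%Z).
Proof. by rewrite -residueE. Qed.

Lemma residue_ord (j : 'I_q) (c : int) : residue (j%:Z + q%:Z * c) = j.
Proof.
by apply/eqP; rewrite eq_sym eq_residue mulrC addrC modzMDl modz_nat modn_small.
Qed.

Lemma Kmx_residuel n (j : 'I_q) :
  Kmx R q (residue n) j = (j == residue (n + 1))%:R.
Proof.
rewrite mxE eq_residue; congr (nat_of_bool _)%:R.
by rewrite -eqz_nat -!modz_nat modz_nat modn_small // -addn1 PoszD residueE modzDml.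
Qed.

Lemma Kmx_residuer n (j : 'I_q) :
  Kmx R q j (residue n) = (j == residue (n - 1))%:R.
Proof.
rewrite -[in LHS](residue_ord j 0) mulr0 addr0 Kmx_residuel !eq_residue residueE.
by rewrite -(eqz_modDr (- 1)) addrK modz_nat (modn_small (ltn_ord j)) eq_sym.
Qed.

Variables theta1 theta2 : R.

(** The signs are such that [tau1s] contributes e^(2 i pi theta1) and [tau2] contributes e^(2 i pi
    theta2), the factors that accompany K and J in the Bloch matrix. *)
Definition phase (a : int * int) : R[i] :=
  expi (2 * pi * (theta1 * a.1%:~R - theta2 * a.2%:~R)).

(** Up to the phase, the wave depends only on the first coordinate modulo q: in this gauge the
    magnetic factor e^(i gamma a1) has period q in a1 and does not involve a2. *)
Definition wave (x : 'cV[R[i]]_q) : int * int -> R[i] :=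
  fun a => phase a * x (residue a.1) 0.

(* The matrix [A] represents [T] on the waves of fixed quasi-momentum. *)
Definition implements (T : (int * int -> R[i]) -> int * int -> R[i])
    (A : 'M[R[i]]_q) :=
  forall x, T (wave x) = wave (A *m x).

Lemma implements0 : implements 0 0.
Proof.
by move=> x; apply/funext => a; rewrite /wave mul0mx mxE mulr0.
Qed.

Lemma implementsD T U A B :
  implements T A -> implements U B -> implements (T + U) (A + B).
Proof.
move=> hT hU x; apply/funext => a.
by rewrite !fctE hT hU /wave mulmxDl [X in _ = _ * X]mxE mulrDr.
Qed.

Lemma implementsZ c T A : implements T A -> implements (c *: T) (c *: A).
Proof.
move=> hT x; apply/funext => a.
by rewrite !fctE hT /wave -scalemxAl [X in _ = _ * X]mxE; exact: mulrCA.
Qed.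

Lemma implements_comp T U A B :
  implements T A -> implements U B -> implements (T \o U) (A *m B).
Proof. by move=> hT hU x; rewrite /= hU hT mulmxA. Qed.

Lemma conj_mxE m n (A : 'M[R[i]]_(m, n)) i j : (A ^t*)%sesqui i j = (A j i)^*.
Proof. by rewrite !mxE. Qed.

Lemma implements_tau1s :
  implements (@tau1s R) (expi (2 * pi * theta1) *: Kmx R q).
Proof.
move=> x; apply/funext => -[a b]; rewrite /tau1s /wave /= -scalemxAl !mxE.
rewrite (bigD1 (residue (a + 1))) //= big1 ?addr0 => [|j /negPf jn]; last first.
  by rewrite Kmx_residuel jn mul0r.
rewrite Kmx_residuel eqxx mul1r mulrCA mulrA; congr (_ * _).
by rewrite /phase -expiD; congr expi; rewrite intrD /=; ring.
Qed.

Lemma implements_tau1 :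
  implements (@tau1 R) (expi (- (2 * pi * theta1)) *: (Kmx R q) ^t*%sesqui).
Proof.
move=> x; apply/funext => -[a b]; rewrite /tau1 /wave /= -scalemxAl !mxE.
rewrite (bigD1 (residue (a - 1))) //= big1 ?addr0 => [|j /negPf jn]; last first.
  by rewrite conj_mxE Kmx_residuer jn conjC0 mul0r.
rewrite conj_mxE Kmx_residuer eqxx conjC1 mul1r mulrCA mulrA; congr (_ * _).
by rewrite /phase -expiD; congr expi; rewrite intrB /=; ring.
Qed.

Variable p : nat.
Let gamma : R := 2 * pi * p%:R / q%:R.

(** Since gamma q = 2 pi p, moving n by a multiple of q moves gamma n by a multiple of 2 pi. *)
Lemma expi_residue n :
  expi (2 * pi * (residue n)%:R * p%:R / q%:R) = expi (gamma * n%:~R) :> R[i].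
Proof.
have q0 : (q%:R : R) != 0 by rewrite pnatr_eq0 -lt0n.
have -> : (residue n)%:R = n%:~R - q%:R * (n %/ q)%Z%:~R :> R.
  rewrite !pmulrn residueE -intrM -intrB; congr _%:~R.
  by rewrite mulrC.
rewrite -[RHS]mul1r -(expi_period R (- ((n %/ q)%Z * p%:Z))) -expiD; congr expi.
by rewrite /gamma intrN intrM -!pmulrn; field.
Qed.

Lemma implements_tau2 :
  implements (@tau2 R gamma) (expi (2 * pi * theta2) *: Jmx R p q).
Proof.
move=> x; apply/funext => -[a b]; rewrite /tau2 /wave /= -scalemxAl mul_diag_mx !mxE.
have -> : phase (a, b - 1) = expi (2 * pi * theta2) * phase (a, b).
  by rewrite /phase -expiD; congr expi; rewrite intrB /=; ring.
by rewrite expi_residue; ring.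
Qed.

Lemma implements_tau2s :
  implements (@tau2s R gamma) (expi (- (2 * pi * theta2)) *: (Jmx R p q) ^t*%sesqui).
Proof.
move=> x; apply/funext => -[a b]; rewrite /tau2s /wave /= -scalemxAl.
have -> : phase (a, b + 1) = expi (- (2 * pi * theta2)) * phase (a, b).
  by rewrite /phase -expiD; congr expi; rewrite intrD /=; ring.
rewrite tr_diag_mx map_diag_mx mxE mul_diag_mx !mxE expi_residue expiN.
ring.
Qed.

End BlochWaves.

(** * Algebra of conjugate transposes *)

Section AdjointMatrix.
Variable R : realType.
Local Open Scope sesquilinear_scope.

Lemma adjD m n (A B : 'M[R[i]]_(m, n)) : (A + B)^t* = A^t* + B^t*.
Proof. by rewrite linearD map_mxD. Qed.

Lemma adjZ m n c (A : 'M[R[i]]_(m, n)) : (c *: A)^t* = c^* *: A^t*.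
Proof. by rewrite linearZ map_mxZ. Qed.

Lemma adjM m n l (A : 'M[R[i]]_(m, n)) (B : 'M[R[i]]_(n, l)) :
  (A *m B)^t* = B^t* *m A^t*.
Proof. by rewrite trmx_mul map_mxM. Qed.

Lemma adjK m n (A : 'M[R[i]]_(m, n)) : (A^t*)^t* = A.
Proof. by apply/matrixP => i j; rewrite !mxE conjCK. Qed.

Lemma adj_lin m n c a b (A B : 'M[R[i]]_(m, n)) :
  (c *: (a *: A + b *: B))^t* = c^* *: (a^* *: A^t* + b^* *: B^t*).
Proof. by rewrite adjZ adjD !adjZ. Qed.

Lemma scalemxM m n l c a b (A : 'M[R[i]]_(m, n)) (B : 'M[R[i]]_(n, l)) :
  c *: ((a *: A) *m (b *: B)) = (c * (a * b)) *: (A *m B).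
Proof. by rewrite -scalemxAl -scalemxAr !scalerA mulrA. Qed.

End AdjointMatrix.

(** * The entries of Q are implemented by the blocks of the Bloch matrix *)

Section BlochOperator.
Variables (R : realType) (p q : nat) (q_gt0 : (0 < q)%N).
Variables omega theta1 theta2 : R.
Local Open Scope sesquilinear_scope.
Let gamma : R := 2 * pi * p%:R / q%:R.
Let q0 : (q%:R : R) != 0.
Proof. by rewrite pnatr_eq0 -lt0n. Qed.

(** The commutation relation of the magnetic translations. K links index i to i + 1, where the
    diagonal of J has gained a factor e^(i gamma). Writing i as a residue takes care of the
    wrap-around from q - 1 to 0. *)
Lemma Jmx_Kmx : Jmx R p q *m Kmx R q = expi (- gamma) *: (Kmx R q *m Jmx R p q).
Proof.
apply/matrixP => i j; rewrite mul_diag_mx mul_mx_diag.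
rewrite [LHS]mxE [X in X * _]mxE [RHS]mxE [X in _ = _ * X]mxE [X in _ = _ * (_ * X)]mxE.
rewrite -(residue_ord q_gt0 i 0) mulr0 addr0 Kmx_residuel.
case: eqP => [->|_]; last by rewrite !(mulr0, mul0r).
rewrite !expi_residue mul1r mulr1 -expiD; congr expi.
by rewrite intrD /gamma; ring.
Qed.

(** Taking adjoints reverses the product, whereas Q keeps the [tau1] factor on the left. Restoring
    that order costs e^(-i gamma), which turns the conjugated factor e^(i gamma / 2) back into the
    e^(-i gamma / 2) that occurs in Q. *)
Lemma adj_KJ : (Kmx R q *m Jmx R p q)^t* =
  expi (- gamma) *: ((Kmx R q)^t* *m (Jmx R p q)^t*).
Proof.
have -> : Kmx R q *m Jmx R p q = expi gamma *: (Jmx R p q *m Kmx R q).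
  by rewrite Jmx_Kmx scalerA -expiD subrr expi0 scale1r.
by rewrite adjZ adjM expiN.
Qed.

Definition emb (i : 'I_3) (j : 'I_q) : 'I_(q + (q + q)) :=
  match val i with
  | 0 => lshift _ j
  | 1 => rshift _ (lshift _ j)
  | _ => rshift _ (rshift _ j)
  end.

Definition block (y : 'cV[R[i]]_(q + (q + q))) (i : 'I_3) : 'cV[R[i]]_q :=
  \col_j y (emb i j) 0.

Definition bloch_entry (i j : nat) : 'M[R[i]]_q :=
  match i, j with
  | 0, 1 => M13 p q omega theta1 theta2
  | 0, 2 => M15 p q omega theta1 theta2
  | 1, 0 => (M13 p q omega theta1 theta2)^t*
  | 1, 2 => M35 p q omega theta1 theta2
  | 2, 0 => (M15 p q omega theta1 theta2)^t*
  | 2, 1 => (M35 p q omega theta1 theta2)^t*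
  | _, _ => 0
  end.

Lemma block_blochM y i : block (blochM p q omega theta1 theta2 *m y) i =
  \sum_(j < 3) bloch_entry i j *m block y j.
Proof.
pose y0 := usubmx y; pose y1 := usubmx (dsubmx y); pose y2 := dsubmx (dsubmx y).
have yE : y = col_mx y0 (col_mx y1 y2) by rewrite !vsubmxK.
have b0 z0 z1 z2 : block (col_mx z0 (col_mx z1 z2)) (@Ordinal 3 0 isT) = z0.
  by apply/colP => j; rewrite mxE /emb /= col_mxEu.
have b1 z0 z1 z2 : block (col_mx z0 (col_mx z1 z2)) (@Ordinal 3 1 isT) = z1.
  by apply/colP => j; rewrite mxE /emb /= col_mxEd col_mxEu.
have b2 z0 z1 z2 : block (col_mx z0 (col_mx z1 z2)) (@Ordinal 3 2 isT) = z2.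
  by apply/colP => j; rewrite mxE /emb /= !col_mxEd.
rewrite /blochM yE mul_block_col mul_col_mx mul_row_col mul_block_col.
rewrite !mul0mx !add0r addr0 add_col_mx.
rewrite !big_ord_recl big_ord0 addr0.
have -> : lift ord0 ord0 = @Ordinal 3 1 isT by exact: val_inj.
have -> : lift ord0 (lift ord0 ord0) = @Ordinal 3 2 isT by exact: val_inj.
have -> : ord0 = @Ordinal 3 0 isT by exact: val_inj.
rewrite b0 b1 b2.
by case: i => [[|[|[|//]]]] h; rewrite ?(bool_irrelevance h isT) ?b0 ?b1 ?b2 /=
  ?mul0mx ?addr0 ?add0r.
Qed.

Let e : R := omega + pi / 4 * (p%:R / q%:R).
Let h : R := pi * (p%:R / q%:R).
Let K := Kmx R q.
Let J := Jmx R p q.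
Let k : R := 2 * pi * theta1.
Let j : R := 2 * pi * theta2.

(** Here and in the next five lemmas, the quasi-momentum phases are attached to the individual
    factors K and J. Each block then has the shape of the corresponding entry of Q, with every
    translation replaced by the matrix that implements it. *)
Lemma M13E : M13 p q omega theta1 theta2 =
  expi e *: (expi k *: K + expi (- h) *: ((expi k *: K) *m (expi j *: J))).
Proof.
rewrite /M13 scalemxM; congr (_ *: (_ + _ *: _)).
by rewrite mulrA -!expiD; congr expi; rewrite /h /k /j; ring.
Qed.

Lemma adj_M13 : (M13 p q omega theta1 theta2)^t* =
  expi (- e) *: (expi (- k) *: K^t* +
    expi (- h) *: ((expi (- k) *: K^t*) *m (expi (- j) *: J^t*))).
Proof.
rewrite /M13 adj_lin adj_KJ rmorphM /= -!expiN scalemxM scalerA.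
congr (_ *: (_ + _ *: _)).
by rewrite mulrA -!expiD; congr expi; rewrite /gamma /h /k /j; field.
Qed.

Lemma M15E : M15 p q omega theta1 theta2 =
  expi (- e) *: (expi k *: K + expi (- j) *: J^t*).
Proof. by []. Qed.

Lemma adj_M15 : (M15 p q omega theta1 theta2)^t* =
  expi e *: (expi (- k) *: K^t* + expi j *: J).
Proof. by rewrite /M15 adj_lin -!expiN !opprK adjK. Qed.

Lemma M35E : M35 p q omega theta1 theta2 =
  expi e *: (expi (- h) *: ((expi (- k) *: K^t*) *m (expi (- j) *: J^t*))
             + expi (- j) *: J^t*).
Proof.
rewrite /M35 [X in _ = _ *: (X + _)]scalemxM.
congr (_ *: _).
congr (_ + _).
congr (_ *: _).
by rewrite mulrA -!expiD; congr expi; rewrite /h /k /j; ring.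
Qed.

Lemma adj_M35 : (M35 p q omega theta1 theta2)^t* =
  expi (- e) *: (expi (- h) *: ((expi k *: K) *m (expi j *: J)) + expi j *: J).
Proof.
rewrite /M35 adj_lin adjM !adjK -/J -/K Jmx_Kmx scalerA rmorphM /= -!expiN !opprK.
rewrite [X in _ = _ *: (X + _)]scalemxM.
congr (_ *: _).
congr (_ + _).
congr (_ *: _).
by rewrite !mulrA -!expiD; congr expi; rewrite /gamma /h /k /j; field.
Qed.

(** Each entry of Q is built from the four translations by sums, multiples and compositions, all of
    which [implements] respects. *)
Lemma implements_Qentry a b :
  implements q_gt0 theta1 theta2 (Qentry gamma omega a b) (bloch_entry a b).
Proof.
have eE : omega + gamma / 8 = e by rewrite /gamma /e; field.
have hE : gamma / 2 = h by rewrite /gamma /h; field.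
have t1 := @implements_tau1 R q q_gt0 theta1 theta2.
have t1' := @implements_tau1s R q q_gt0 theta1 theta2.
have t2 := @implements_tau2 R q q_gt0 theta1 theta2 p.
have t2' := @implements_tau2s R q q_gt0 theta1 theta2 p.
have im0 := @implements0 R q q_gt0 theta1 theta2.
have imD := @implementsD R q q_gt0 theta1 theta2.
have imZ := @implementsZ R q q_gt0 theta1 theta2.
have imM := @implements_comp R q q_gt0 theta1 theta2.
case: a => [|[|[|a]]]; case: b => [|[|[|b]]]; rewrite /Qentry /bloch_entry ?eE ?hE.
- exact: im0.
- by rewrite M13E; apply: imZ (imD _ _ _ _ t1' (imZ _ _ _ (imM _ _ _ _ t1' t2))).
- by rewrite M15E; apply: imZ (imD _ _ _ _ t1' t2').
- exact: im0.
- by rewrite adj_M13; apply: imZ (imD _ _ _ _ t1 (imZ _ _ _ (imM _ _ _ _ t1 t2'))).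
- exact: im0.
- by rewrite M35E; apply: imZ (imD _ _ _ _ (imZ _ _ _ (imM _ _ _ _ t1 t2')) t2').
- exact: im0.
- by rewrite adj_M15; apply: imZ (imD _ _ _ _ t1 t2).
- by rewrite adj_M35; apply: imZ (imD _ _ _ _ (imZ _ _ _ (imM _ _ _ _ t1' t2)) t2).
all: exact: im0.
Qed.

End BlochOperator.

Section BlochWave.
Variables (R : realType) (p q : nat) (q_gt0 : (0 < q)%N).
Variables omega theta1 theta2 : R.

Definition bloch_wave (y : 'cV[R[i]]_(q + (q + q))) : int * int -> 'cV[R[i]]_3 :=
  fun a => \col_i wave q_gt0 theta1 theta2 (block y i) a.

Lemma Q_bloch_wave y : Q (2 * pi * p%:R / q%:R) omega (bloch_wave y) =
  bloch_wave (blochM p q omega theta1 theta2 *m y).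
Proof.
apply/funext => a; apply/colP => i; rewrite /Q /opmx mxE [RHS]mxE block_blochM.
rewrite /wave summxE mulr_sumr; apply: eq_bigr => j _.
rewrite -[RHS]/(wave q_gt0 theta1 theta2 _ a) -implements_Qentry.
by congr (Qentry _ _ _ _ _ a); apply/funext => b; rewrite mxE.
Qed.

Lemma bloch_wave_linear c y z :
  bloch_wave (c *: y + z) = c *: bloch_wave y + bloch_wave z.
Proof.
apply/funext => a; apply/colP => i; rewrite !fctE !mxE /wave !mxE.
by rewrite mulrDr; congr (_ + _); exact: mulrCA.
Qed.

End BlochWave.

(** * Finite-range operators *)

Section FiniteRange.
Variable R : realType.
Local Notation F := (int * int -> R[i]).

Definition scalar_finite_range (T : F -> F) :=
  exists s : seq (F * (int * int)),
    forall v a, T v a = \sum_(x <- s) x.1 a * v (Defs.shift x.2 a).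

Lemma scalar_finite_range_shift (c : F) s :
  scalar_finite_range (fun v a => c a * v (Defs.shift s a)).
Proof. by exists [:: (c, s)] => v a; rewrite big_seq1. Qed.

Lemma scalar_finite_range0 : scalar_finite_range 0.
Proof. by exists [::] => v a; rewrite big_nil. Qed.

Lemma scalar_finite_rangeD T U :
  scalar_finite_range T -> scalar_finite_range U -> scalar_finite_range (T + U).
Proof.
by move=> [s hs] [t ht]; exists (s ++ t) => v a; rewrite big_cat /= -hs -ht.
Qed.

Lemma scalar_finite_rangeZ c T : scalar_finite_range T -> scalar_finite_range (c *: T).
Proof.
move=> [s hs]; exists [seq (fun a => c * x.1 a, x.2) | x <- s] => v a.
rewrite big_map -[LHS]/(c * T v a) hs mulr_sumr.
by apply: eq_bigr => x _; rewrite mulrA.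
Qed.

Lemma scalar_finite_range_comp T U : scalar_finite_range T -> scalar_finite_range U ->
  scalar_finite_range (T \o U).
Proof.
move=> [s hs] [t ht].
exists [seq (fun a => x.1 a * y.1 (Defs.shift x.2 a), (x.2.1 + y.2.1, x.2.2 + y.2.2))
       | x <- s, y <- t] => v a.
rewrite big_allpairs_dep /= hs; apply: eq_bigr => x _; rewrite ht mulr_sumr.
apply: eq_bigr => y _ /=; rewrite mulrA; congr (_ * v _).
by rewrite /Defs.shift /= !addrA.
Qed.

Lemma Qentry_finite_range gamma omega i j : scalar_finite_range (@Qentry R gamma omega i j).
Proof.
have t1 : scalar_finite_range (@tau1 R).
  have [s hs] := scalar_finite_range_shift (fun=> 1) (- 1, 0).
  by exists s => v [a b]; rewrite -hs /Defs.shift /= mul1r addr0.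
have t1' : scalar_finite_range (@tau1s R).
  have [s hs] := scalar_finite_range_shift (fun=> 1) (1, 0).
  by exists s => v [a b]; rewrite -hs /Defs.shift /= mul1r addr0.
have t2 : scalar_finite_range (tau2 gamma).
  have [s hs] := scalar_finite_range_shift (fun a => expi (gamma * a.1%:~R)) (0, - 1).
  by exists s => v [a b]; rewrite -hs /Defs.shift /= addr0.
have t2' : scalar_finite_range (tau2s gamma).
  have [s hs] := scalar_finite_range_shift (fun a => expi (- (gamma * a.1%:~R))) (0, 1).
  by exists s => v [a b]; rewrite -hs /Defs.shift /= addr0.
by case: i => [|[|[|i]]]; case: j => [|[|[|j]]]; rewrite /Qentry;
  repeat first [exact: scalar_finite_range0 | exact: t1 | exact: t1' | exact: t2 | exact: t2'
    | apply: scalar_finite_rangeZ | apply: scalar_finite_rangeD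
    | apply: scalar_finite_range_comp].
Qed.

(** This form makes sense on arbitrary functions, in particular on Bloch waves, which are not square
    summable unless zero. It yields linearity, locality and continuity under pointwise limits. *)
Definition finite_range n (T : (int * int -> 'cV[R[i]]_n) -> int * int -> 'cV[R[i]]_n) :=
  exists s : seq ((int * int -> 'M[R[i]]_n) * (int * int)),
    forall v a, T v a = \sum_(x <- s) x.1 a *m v (Defs.shift x.2 a).

Lemma Q_finite_range gamma omega : finite_range (@Q R gamma omega).
Proof.
have /choice[s hs] (ij : 'I_3 * 'I_3) : exists s : seq (F * (int * int)),
    forall v a, Qentry gamma omega ij.1 ij.2 v a =
      \sum_(x <- s) x.1 a * v (Defs.shift x.2 a) by exact: Qentry_finite_range.
(* A scalar coefficient of the entry (i, j) becomes a multiple of the elementary matrix at (i,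
   j). *)
exists [seq (fun a => x.1 a *: delta_mx ij.1 ij.2, x.2)
       | ij <- enum {: 'I_3 * 'I_3}, x <- s ij] => v a.
rewrite big_allpairs_dep /= big_enum /= /Q /opmx; apply/colP => i.
rewrite mxE summxE (eq_bigr (fun ij => (fun k l => (\sum_(x <- s (k, l))
  (x.1 a *: delta_mx k l) *m v (Defs.shift x.2 a)) i 0) ij.1 ij.2)); last by case.
rewrite -(pair_bigA _ (fun k l => (\sum_(x <- s (k, l))
  (x.1 a *: delta_mx k l) *m v (Defs.shift x.2 a)) i 0)) /=.
rewrite [RHS](bigD1 i) //= [X in _ = _ + X]big1 ?addr0 => [|k /negPf ki]; last first.
  rewrite big1 // => l _; rewrite summxE big1 // => x _.
  rewrite -scalemxAl !mxE big1 ?mulr0 // => m _.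
  by rewrite mxE eq_sym ki mul0r.
apply: eq_bigr => l _; rewrite (hs (i, l)) summxE; apply: eq_bigr => x _.
rewrite -scalemxAl !mxE (bigD1 l) //= big1 ?addr0 => [|m /negPf ml]; last first.
  by rewrite mxE ml andbF mul0r.
by rewrite mxE !eqxx mul1r.
Qed.

End FiniteRange.

(** * Energy on boxes *)

Section VectorSquare.
Variable R : realType.

Definition vsq n (x : 'cV[R[i]]_n) : R := \sum_(j < n) normc (x j 0) ^+ 2.

Lemma vsq_ge0 n (x : 'cV[R[i]]_n) : 0 <= vsq x.
Proof. by apply: sumr_ge0 => j _; rewrite sqr_ge0. Qed.

Lemma vsq0 n : vsq (0 : 'cV[R[i]]_n) = 0.
Proof. by rewrite /vsq big1 // => j _; rewrite mxE normc0 expr0n. Qed.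

Lemma normc_sqC (z : R[i]) : (normc z ^+ 2)%:C = z * z^*.
Proof. by rewrite -normCK rmorphXn. Qed.

Lemma vsqC n (x : 'cV[R[i]]_n) : (vsq x)%:C = \sum_j x j 0 * (x j 0)^*.
Proof. by rewrite rmorph_sum; apply: eq_bigr => j _; rewrite /= normc_sqC. Qed.

Lemma vsq_eq0 n (x : 'cV[R[i]]_n) : vsq x = 0 -> x = 0.
Proof.
move=> /eqP; rewrite psumr_eq0 => [/allP h|j _]; last exact: sqr_ge0.
apply/colP => j; rewrite mxE; apply: eq0_normc; apply/eqP.
by have := h j; rewrite mem_index_enum sqrf_eq0 => /(_ isT).
Qed.

Lemma vsqZ n c (x : 'cV[R[i]]_n) : vsq (c *: x) = normc c ^+ 2 * vsq x.
Proof.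
by rewrite mulr_sumr; apply: eq_bigr => j _; rewrite mxE normcM exprMn.
Qed.

End VectorSquare.

(** * Boxes in Z^2 and their behaviour under translation *)

Section Boxes.
Variables (q : nat) (q_gt0 : (0 < q)%N).

(* Boxes consist of whole periods in the first coordinate, so that all residues
   modulo [q] play the same role. *)
Definition box (h : nat) : set (int * int) :=
  [set a | ((`|(a.1 %/ q)%Z| <= h) && (`|a.2| <= h))%N].

(** The residue is kept apart from the pair formed by the period and the second coordinate, both
    offset by h. The Fourier transform acts on that pair alone, and the same finite type of pairs
    indexes the quasi-momenta. *)
Definition box_index (h : nat) : finType := ('I_q * ('I_(h.*2.+1) * 'I_(h.*2.+1)))%type.

Definition box_point (h : nat) (x : box_index h) : int * int :=
  (x.1%:Z + q%:Z * (x.2.1%:Z - h%:Z), x.2.2%:Z - h%:Z).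

Lemma box_point_divz h (x : box_index h) : ((box_point x).1 %/ q)%Z = (x.2.1)%:Z - h%:Z.
Proof.
rewrite /= addrC [_ * (_ - _)]mulrC divzMDl; last by rewrite eqz_nat -lt0n.
by rewrite divz_nat divn_small ?addr0.
Qed.

Lemma box_point_bij h : set_bij [set: box_index h] (box h) (@box_point h).
Proof.
split.
- move=> x _; rewrite /box /= -[X in (X %/ _)%Z]/((box_point x).1) box_point_divz.
  have := ltn_ord x.2.2; have := ltn_ord x.2.1.
  by move: (nat_of_ord x.2.1) (nat_of_ord x.2.2) => k l; lia.
- move=> x y _ _ exy; have := congr1 (fun a => (a.1 %/ q)%Z) exy.
  rewrite !box_point_divz => /addIr [e1]; move: exy => [] + /addIr [e2].
  rewrite e1 => /addIr [e3].
  case: x y e1 e2 e3 => [x1 [x2 x3]] [y1 [y2 y3]] /= e1 e2 e3.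
  by congr (_, (_, _)); exact: val_inj.
- move=> [a b]; rewrite /box /= => /andP[ha hb].
  have h1 : (`|((a %/ q)%Z + h%:Z)%R| < h.*2.+1)%N by lia.
  have h2 : (`|(b + h%:Z)%R| < h.*2.+1)%N by lia.
  exists (residue q_gt0 a, (Ordinal h1, Ordinal h2)) => //.
  rewrite /box_point /= !gez0_abs ?modz_ge0; try lia.
  by rewrite !addrK mulrC addrC -divz_eq.
Qed.

Lemma subset_box h h' : (h <= h')%N -> box h `<=` box h'.
Proof. by move=> hh' a; rewrite /box /= => /andP[]; lia. Qed.

(** Translating by s1 moves the quotient by q by at most |s1|, because q is at least 1. *)
Lemma box_shift (s a : int * int) h :
  box h a -> box (h + `|s.1| + `|s.2|) (Defs.shift s a).
Proof.
case: s a => [s1 s2] [a1 a2]; rewrite /box /Defs.shift /= => /andP[h1 h2].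
have e1 := divz_eq a1 q; have e2 := divz_eq (a1 + s1) q.
have m1 := @modz_ge0 a1 q; have m2 := @modz_ge0 (a1 + s1) q.
have l1 := @ltz_pmod a1 q; have l2 := @ltz_pmod (a1 + s1) q.
set c := (a1 %/ q)%Z in h1 e1 *; set d := ((a1 + s1) %/ q)%Z in e2 *.
set j := (a1 %% q)%Z in e1 m1 l1; set k := ((a1 + s1) %% q)%Z in e2 m2 l2.
suff : (`|d - c| <= `|s1|)%N by lia.
have {}m1 : 0 <= j by apply: m1; lia.
have {}m2 : 0 <= k by apply: m2; lia.
have {}l1 : j < q by apply: l1; lia.
have {}l2 : k < q by apply: l2; lia.
have E : (d - c) * q%:Z = s1 + j - k by lia.
move: (d - c : int) E => e E.
(* If |e| exceeded |s1|, then |e| q would be at least |s1| q + q, but it equals |s1 + j - k| with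
   remainders j, k below q. *)
have [//|lt] := leqP; exfalso.
have : (`|s1|.+1 * q <= `|e| * q)%N by rewrite leq_mul2r lt orbT.
have : (`|e| * q = `|(e * q%:Z)%R|)%N by rewrite abszM.
rewrite E; nia.
Qed.

Lemma finite_box (X : set (int * int)) : finite_set X -> exists h, X `<=` box h.
Proof.
move=> /finite_fsetP[Y ->].
exists (\sum_(a <- Y) (`|(a.1 %/ q)%Z| + `|a.2|))%N => a /= aY.
by rewrite /box /= (big_rem a) //=; lia.
Qed.

Lemma box_shifts (T : Type) (s : seq (T * (int * int))) : exists r,
  forall h a, box h a -> forall x, List.In x s -> box (h + r) (Defs.shift x.2 a).
Proof.
elim: s => [|x s [r hr]]; first by exists 0%N.
exists (`|x.2.1| + `|x.2.2| + r)%N => h a ha y [<-|ys].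
  by apply: subset_box (box_shift x.2 ha); lia.
by apply: subset_box (hr _ _ ha _ ys); lia.
Qed.

End Boxes.

(** * Squared norms, cutoffs and their restriction to boxes *)

Section Energy.
Variables (R : realType) (n q : nat) (q_gt0 : (0 < q)%N).
Local Notation V := (int * int -> 'cV[R[i]]_n).
Implicit Types u v : V.

(** The squared l^2 norm as a real number. It is 0 by default when the sum diverges, so bounds on it
    are stated together with membership in [l2]. *)
Definition energy v : R := fine (sqnorm v).

Definition cutoff (A : set (int * int)) v : V := fun a => if a \in A then v a else 0.

Definition box_energy h v : R := \sum_(x : box_index q h) vsq (v (box_point x)).

Lemma sqnormE v : sqnorm v = \esum_(a in [set: int * int]) (vsq (v a))%:E.
Proof. by []. Qed.

Lemma sqnorm_ge0 v : (0 <= sqnorm v)%E.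
Proof. by apply: esum_ge0 => a _; rewrite lee_fin vsq_ge0. Qed.

Lemma energyE v : l2 v -> sqnorm v = (energy v)%:E.
Proof. by move=> v2; rewrite fineK // ge0_fin_numE // sqnorm_ge0. Qed.

Lemma energy_ge0 v : 0 <= energy v.
Proof. by rewrite fine_ge0 // sqnorm_ge0. Qed.

Lemma energy_le v (C : R) : (sqnorm v <= C%:E)%E -> l2 v /\ energy v <= C.
Proof.
move=> vC; have v2 : l2 v by apply: le_lt_trans vC _; rewrite ltry.
by split=> //; rewrite -lee_fin -energyE.
Qed.

Lemma le_energy u v : (forall a, vsq (u a) <= vsq (v a)) -> l2 v ->
  l2 u /\ energy u <= energy v.
Proof.
move=> uv v2; apply: energy_le; rewrite -energyE //.
by apply: le_esum => a _; rewrite lee_fin; exact: uv.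
Qed.

Lemma energyD u v : l2 u -> l2 v ->
  l2 (u + v) /\ energy (u + v) <= (energy u + energy v) *+ 2.
Proof.
move=> u2 v2; apply: energy_le; rewrite mulr2n EFinD EFinD -!energyE //.
rewrite !sqnormE -!esumD; try by move=> a _; repeat apply: adde_ge0; rewrite lee_fin vsq_ge0.
apply: le_esum => a _; rewrite -!EFinD lee_fin -!big_split /=.
apply: ler_sum => j _; rewrite fctE mxE.
set x := u a j 0; set y := v a j 0.
have : normc (x + y) ^+ 2 <= (normc x + normc y) ^+ 2.
  by rewrite lerXn2r ?nnegrE ?addr_ge0 ?le_normcD //; case: (x) (y) => ? ? [? ?];
    rewrite ?addr_ge0 ?sqrtr_ge0.
by move=> /le_trans; apply; have := sqr_ge0 (normc x - normc y); nra.
Qed.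

Lemma sqnorm_cutoff A v : sqnorm (cutoff A v) = \esum_(a in A) (vsq (v a))%:E.
Proof.
rewrite esum_mkcond; apply: eq_esum => a _; rewrite /cutoff.
by case: ifP => // _; rewrite -/(vsq _) vsq0.
Qed.

Lemma sqnorm_cutoffC A v :
  (sqnorm v = sqnorm (cutoff A v) + sqnorm (cutoff (~` A) v))%E.
Proof.
by rewrite !sqnorm_cutoff sqnormE [LHS](esumID A) ?setTI // => a _; rewrite lee_fin vsq_ge0.
Qed.

Lemma sqnorm_box h v : sqnorm (cutoff (box q h) v) = (box_energy h v)%:E.
Proof.
rewrite sqnorm_cutoff (reindex_esum _ _ _ _ (box_point_bij q_gt0 h)).
rewrite esum_fset //; last first.
  by move=> i _; rewrite lee_fin vsq_ge0.
  exact: finite_finset.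
rewrite /box_energy -sumEFin [RHS]fsbig_seq ?index_enum_uniq //.
by apply: eq_fsbigl; apply/seteqP; split=> x // _; rewrite /= mem_index_enum.
Qed.

Lemma l2_cutoff A v : l2 v -> l2 (cutoff A v).
Proof.
by move=> v2; apply: le_lt_trans v2; rewrite (sqnorm_cutoffC A v) leeDl ?sqnorm_ge0.
Qed.

Lemma energy_cutoffC A v : l2 v -> energy v = energy (cutoff A v) + energy (cutoff (~` A) v).
Proof.
move=> v2; apply: EFin_inj.
rewrite EFinD -(energyE v2) -!(energyE (l2_cutoff _ v2)); exact: sqnorm_cutoffC.
Qed.

Lemma l2_box h v : l2 (cutoff (box q h) v).
Proof. by rewrite /l2 /= sqnorm_box ltry. Qed.

Lemma energy_box h v : energy (cutoff (box q h) v) = box_energy h v.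
Proof. by rewrite /energy sqnorm_box. Qed.

Lemma box_energy_le h v : l2 v -> box_energy h v <= energy v.
Proof. by move=> v2; rewrite (energy_cutoffC (box q h) v2) energy_box lerDl energy_ge0. Qed.

(** The sum over Z^2 is a supremum over finite sets, and each of these lies in a box. *)
Lemma sqnorm_le_box v C :
  (forall h, box_energy h v <= C) -> (sqnorm v <= C%:E)%E.
Proof.
move=> vC; apply: ge_ereal_sup => _ [X [finX _] <-].
have [h Xh] := finite_box q_gt0 finX.
apply: (@le_trans _ _ (box_energy h v)%:E); last by rewrite lee_fin.
rewrite -sqnorm_box sqnorm_cutoff; apply: esum_ge; exists X => //.
Qed.

Lemma energy_eq0 v : l2 v -> energy v = 0 -> v = 0.
Proof.
move=> v2 v0; apply/funext => a; apply: vsq_eq0; apply/eqP.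
rewrite eq_le vsq_ge0 andbT -lee_fin.
have <- : sqnorm v = 0%:E by rewrite energyE // v0.
apply: esum_ge; exists [set a]; last by rewrite fsbig_set1.
by split.
Qed.

Lemma energyZ c v : l2 v -> l2 (c *: v) /\ energy (c *: v) <= normc c ^+ 2 * energy v.
Proof.
move=> v2; apply/energy_le/sqnorm_le_box => h.
apply: (le_trans _ (ler_wpM2l (sqr_ge0 _) (box_energy_le h v2))).
by rewrite mulr_sumr; apply: ler_sum => x _; rewrite fctE vsqZ.
Qed.

End Energy.

Lemma normc_nat (R : realType) n : normc (n%:R : R[i]) = n%:R.
Proof.
apply: (@complexI R); rewrite rmorph_nat.
by rewrite -[LHS]/(`|n%:R : R[i]|) normr_nat.
Qed.

(** * Fourier transform on a box *)

Section Join.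
Variables (R : realType) (q : nat).

Definition join_blocks (g : 'I_3 -> 'cV[R[i]]_q) : 'cV[R[i]]_(q + (q + q)) :=
  col_mx (g ord0) (col_mx (g (@Ordinal 3 1 isT)) (g (@Ordinal 3 2 isT))).

Lemma block_join g i : block (join_blocks g) i = g i.
Proof.
apply/colP => j; rewrite mxE /join_blocks /emb.
case: i => [[|[|[|//]]]] h /=; rewrite ?col_mxEu ?col_mxEd ?col_mxEu ?col_mxEd;
  by congr (g _ _ _); exact: val_inj.
Qed.

Lemma vsq_block (y : 'cV[R[i]]_(q + (q + q))) : vsq y = \sum_i vsq (block y i).
Proof.
rewrite /vsq !big_split_ord /= !big_ord_recl big_ord0 addr0.
by congr (_ + (_ + _)); apply: eq_bigr => j _; rewrite mxE.
Qed.

End Join.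

Section Plancherel.
Variables (R : realType) (q : nat) (q_gt0 : (0 < q)%N) (h : nat).
Local Notation N := (h.*2.+1).
Local Notation grid := ('I_N * 'I_N)%type.

(* Shifting [theta1] by [1 / q] only permutes the Bloch waves, so [theta1] runs
   through [[0, 1/q)] and the waves below form a basis on the box. *)
Definition grid1 (k : grid) : R := k.1%:R / (q%:R * N%:R).
Definition grid2 (k : grid) : R := k.2%:R / N%:R.

Local Notation gphase k := (phase (grid1 k) (grid2 k)).

Let q0 : (q%:R : R) != 0. Proof. by rewrite pnatr_eq0 -lt0n. Qed.
Let N0 : (N%:R : R) != 0. Proof. by rewrite pnatr_eq0. Qed.

Lemma grid1_itv k : 0 <= grid1 k <= 1.
Proof.
rewrite /grid1 divr_ge0 ?mulr_ge0 ?ler0n //= ler_pdivrMr ?mul1r ?mulr_gt0 ?ltr0n //.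
by rewrite -natrM ler_nat; have := ltn_ord k.1; nia.
Qed.

Lemma grid2_itv k : 0 <= grid2 k <= 1.
Proof.
rewrite /grid2 divr_ge0 ?ler0n //= ler_pdivrMr ?mul1r ?ltr0n //.
by rewrite ler_nat; have := ltn_ord k.2; lia.
Qed.

Lemma expi_dftN (t : int) : (`|t| < N)%N ->
  \sum_(k < N) expi (- (2 * pi * (k%:R * t%:~R / N%:R))) = ((t == 0) * N)%:R :> R[i].
Proof.
move=> tN; under eq_bigr do rewrite expiN.
by rewrite -rmorph_sum (expi_dft R tN) /= rmorph_nat.
Qed.

(** Equal residues make a1 - b1 a multiple t1 q, so the q in the denominator of [grid1] cancels. The
    sum over quasi-momenta splits into two one-dimensional sums of roots of unity. *)
Lemma grid_orthogonal (a b : int * int) : residue q_gt0 a.1 = residue q_gt0 b.1 ->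
    (`|(a.1 %/ q)%Z - (b.1 %/ q)%Z| < N)%N -> (`|a.2 - b.2| < N)%N ->
  \sum_(k : grid) gphase k a * (gphase k b)^* = ((a == b) * N ^ 2)%:R.
Proof.
move=> ab h1 h2; set t1 := (a.1 %/ q)%Z - (b.1 %/ q)%Z in h1.
have e1 : a.1 - b.1 = t1 * q%:Z.
  rewrite [in LHS](divz_eq a.1 q) [in X in _ - X](divz_eq b.1 q).
  have := congr1 (fun x : 'I_q => x%:Z) ab; rewrite !residueE => ->.
  by rewrite /t1; ring.
rewrite (eq_bigr (fun k : grid => (fun k1 k2 : 'I_N =>
    expi (2 * pi * (k1%:R * t1%:~R / N%:R)) *
    expi (- (2 * pi * (k2%:R * (a.2 - b.2)%:~R / N%:R)))) k.1 k.2)); last first.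
  move=> k _; rewrite -expiN -!expiD; congr expi; rewrite /grid1 /grid2.
  have -> : a.1 = b.1 + t1 * q%:Z by rewrite -e1 addrC subrK.
  rewrite intrD intrM intrB -pmulrn; move: (N%:R : R) N0 => M M0.
  by field; rewrite q0 M0.
rewrite -(pair_bigA _ (fun k1 k2 : 'I_N =>
    expi (2 * pi * (k1%:R * t1%:~R / N%:R)) *
    expi (- (2 * pi * (k2%:R * (a.2 - b.2)%:~R / N%:R))))) /=.
under eq_bigr do rewrite -mulr_sumr.
rewrite -mulr_suml expi_dft // expi_dftN // -natrM; congr _%:R.
have -> : (a == b) = (t1 == 0) && (a.2 - b.2 == 0).
  rewrite -pair_eqE /pair_eq /= -subr_eq0 e1 mulf_eq0.
  by rewrite eqz_nat (gtn_eqF q_gt0) orbF -[a.2 == b.2]subr_eq0.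
by case: (t1 == 0); case: (_ == 0); rewrite //= ?mul0n ?muln0 // !mul1n.
Qed.

(** The dual relation: two modes are fixed and the sum runs over the points of the box with a given
    residue. *)
Lemma box_orthogonal (j : 'I_q) (k l : grid) :
  \sum_(m : grid) gphase k (box_point ((j, m) : box_index q h)) *
                  (gphase l (box_point ((j, m) : box_index q h)))^* =
  ((k == l) * N ^ 2)%:R.
Proof.
pose t1 : int := k.1%:Z - l.1%:Z; pose t2 : int := k.2%:Z - l.2%:Z.
have h1 : (`|t1| < N)%N by have := ltn_ord k.1; have := ltn_ord l.1; lia.
have h2 : (`|t2| < N)%N by have := ltn_ord k.2; have := ltn_ord l.2; lia.
(* The part of the phase difference that is the same at all these points, due to the residue j and
   the offset by h. It vanishes when k = l. *)
pose c : R := 2 * pi * (t1%:~R * (j%:R - q%:R * h%:R) / (q%:R * N%:R) + t2%:~R * h%:R / N%:R).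
rewrite (eq_bigr (fun m : grid => (fun m1 m2 : 'I_N => expi c *
    (expi (2 * pi * (m1%:R * t1%:~R / N%:R)) *
    expi (- (2 * pi * (m2%:R * t2%:~R / N%:R))))) m.1 m.2)); last first.
  move=> m _; rewrite -expiN -!expiD; congr expi; rewrite /grid1 /grid2 /c /t1 /t2 /=.
  rewrite !intrD !intrM !intrN -!pmulrn; move: (N%:R : R) N0 => M M0.
  by field; rewrite q0 M0.
rewrite -(pair_bigA _ (fun m1 m2 : 'I_N => expi c *
    (expi (2 * pi * (m1%:R * t1%:~R / N%:R)) *
    expi (- (2 * pi * (m2%:R * t2%:~R / N%:R)))))) /=.
under eq_bigr do rewrite -mulr_sumr -mulr_sumr.
rewrite -mulr_sumr -mulr_suml expi_dft // expi_dftN // -natrM.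
have -> : (k == l) = (t1 == 0) && (t2 == 0).
  by rewrite -pair_eqE /pair_eq /t1 /t2 !subr_eq0 !eqz_nat.
case: eqP => t10; case: eqP => t20; rewrite /= ?mul0n ?muln0 ?mulr0 //.
by rewrite /c t10 t20 !mul0r addr0 mulr0 expi0 mul1r !mul1n.
Qed.

Lemma residue_box_point (x : box_index q h) : residue q_gt0 (box_point x).1 = x.1.
Proof. exact: residue_ord. Qed.

(** A discrete Fourier transform for each residue and each component, left unnormalised: followed by
    [synthesis] it multiplies by N^2. *)
Definition analysis (f : int * int -> 'cV[R[i]]_3) (k : grid) :=
  join_blocks (fun i => \col_j \sum_(m : grid)
    (gphase k (box_point ((j, m) : box_index q h)))^* *
    f (box_point ((j, m) : box_index q h)) i 0).

Definition synthesis (Z : grid -> 'cV[R[i]]_(q + (q + q))) : int * int -> 'cV[R[i]]_3 :=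
  fun a => \sum_k bloch_wave q_gt0 (grid1 k) (grid2 k) (Z k) a.

Lemma box_point_inj : injective (@box_point q h).
Proof. by have [_ /in2TT + _] := box_point_bij q_gt0 h. Qed.

(** The synthesised function repeats with period q N in the first coordinate and N in the second.
    For f supported in the box n, the condition n + n' < N keeps the other copies of the support
    away from the box n', which may be larger than the box h of the transform. *)
Lemma synthesis_analysis n n' f a : (n <= h)%N -> (n + n' < N)%N ->
    (forall b, ~ box q n b -> f b = 0) -> box q n' a ->
  synthesis (analysis f) a = (N ^ 2)%:R *: f a.
Proof.
move=> nh nn' f0 an'; apply/colP => i; rewrite summxE [RHS]mxE.
set r := residue q_gt0 a.1.
pose pt m := box_point ((r, m) : box_index q h).
rewrite (eq_bigr (fun k => \sum_m gphase k a * (gphase k (pt m))^* * f (pt m) i 0)); last first.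
  move=> k _; rewrite mxE /wave block_join mxE mulr_sumr.
  by apply: eq_bigr => m _; rewrite mulrA.
rewrite exchange_big /=.
rewrite (eq_bigr (fun m => ((a == pt m) * N ^ 2)%:R * f a i 0)); last first.
  move=> m _; rewrite -mulr_suml.
  have [bn|nb] := pselect (box q n (pt m)); last first.
    have [e|] := eqVneq a (pt m); first by rewrite e (f0 _ nb) mxE !mulr0.
    by rewrite (f0 _ nb) mxE mulr0 mul0n mul0r.
  have /andP[a1 a2] := an'; have /andP[b1 b2] := bn.
  rewrite grid_orthogonal; [|by rewrite residue_box_point|by lia|by lia].
  by case: eqP => [->//|_]; rewrite mul0n !mul0r.
rewrite -mulr_suml -natr_sum -big_distrl /=.
(* Outside the box h both sides vanish, as f does; inside it, exactly one m has [pt m] equal to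
   a. *)
have [ah|ah] := pselect (box q h a); last first.
  by rewrite f0 ?mxE ?mulr0 // => an; apply: ah; exact: (subset_box q_gt0 nh).
congr (_ * _); congr _%:R; rewrite -[RHS]mul1n; congr muln.
have [_ _ /(_ a ah) [[j m] _ ja]] := box_point_bij q_gt0 h.
have rj : r = j by rewrite /r -ja residue_box_point.
rewrite (bigD1 m) //= big1 => [|m' /negPf mm']; first by rewrite /pt rj ja eqxx.
rewrite /pt rj -ja; case: eqP => // /box_point_inj [] e.
by rewrite e eqxx in mm'.
Qed.

(** Plancherel: the square is expanded into pairs of modes, and summing over the points of each
    residue removes the pairs with k different from l. *)
Lemma synthesis_energy Z :
  box_energy q h (synthesis Z) = (N ^ 2)%:R * \sum_k vsq (Z k).
Proof.
apply: (@complexI R); rewrite rmorphM rmorph_nat /= !rmorph_sum /=.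
have E (x : box_index q h) i : synthesis Z (box_point x) i 0 =
    \sum_k gphase k (box_point x) * block (Z k) i x.1 0.
    rewrite summxE; apply: eq_bigr => k _; rewrite mxE /wave; congr (_ * block _ _ _ _).
  exact: residue_box_point.
have E2 (x : box_index q h) : (vsq (synthesis Z (box_point x)))%:C = \sum_i \sum_k \sum_l
    (block (Z k) i x.1 0 * (block (Z l) i x.1 0)^*) *
    (gphase k (box_point x) * (gphase l (box_point x))^*).
  rewrite vsqC; apply: eq_bigr => i _; rewrite E rmorph_sum /= mulr_suml.
  apply: eq_bigr => k _; rewrite mulr_sumr; apply: eq_bigr => l _.
  by rewrite rmorphM /=; ring.
under eq_bigr do rewrite E2.
rewrite exchange_big /= mulr_sumr.
under [RHS]eq_bigr do rewrite vsq_block rmorph_sum /= mulr_sumr.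
rewrite [RHS]exchange_big /=; apply: eq_bigr => i _.
rewrite exchange_big /=; apply: eq_bigr => k _.
rewrite exchange_big /= (bigD1 k) //= [X in _ + X]big1 ?addr0 => [|l lk];
  rewrite -(pair_bigA _ (fun j m => (block (Z k) i j 0 * (block (Z _) i j 0)^*) *
    (gphase k (box_point ((j, m) : box_index q h)) *
    (gphase _ (box_point ((j, m) : box_index q h)))^*))) /=.
- rewrite vsqC mulr_sumr; apply: eq_bigr => j _.
  by rewrite -mulr_sumr box_orthogonal eqxx mul1n mulrC.
- rewrite big1 // => j _.
  by rewrite -mulr_sumr box_orthogonal eq_sym (negPf lk) mul0n mulr0.
Qed.

(** By [synthesis_energy], N^2 times the left side is the energy of the synthesis of [analysis f].
    That function is N^2 f on the box, so its energy there is N^4 times that of f. *)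
Lemma analysis_energy n f : (n <= h)%N -> (forall b, ~ box q n b -> f b = 0) ->
  \sum_k vsq (analysis f k) = (N ^ 2)%:R * box_energy q h f.
Proof.
move=> nh f0; have NN : (N ^ 2)%:R != 0 :> R by rewrite natrX expf_neq0.
apply: (mulfI NN); rewrite -synthesis_energy mulrA -expr2 mulr_sumr.
apply: eq_bigr => x _.
have xh : box q h (box_point x) by have [+ _ _] := box_point_bij q_gt0 h; apply.
rewrite (synthesis_analysis nh _ f0 xh); last by lia.
by rewrite vsqZ normc_nat.
Qed.

End Plancherel.

(** * Uniform invertibility of the Bloch matrices *)

Section ComplexLimits.
Variables (R : realType) (T : Type) (F : set_system T).
Context {FF : Filter F}.
Implicit Types f g : T -> R[i].

Definition ccvg f (z : R[i]) :=
  (fun t => complex.Re (f t)) @ F --> complex.Re z /\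
  (fun t => complex.Im (f t)) @ F --> complex.Im z.

(** Convergence is expressed through real and imaginary parts, so limits of complex values reduce to
    limits in the reals. *)
Lemma ccvg_cst c : ccvg (fun=> c) c.
Proof. by split; exact: cvg_cst. Qed.

Lemma ccvgD f g y z : ccvg f y -> ccvg g z -> ccvg (fun t => f t + g t) (y + z).
Proof.
move=> [f1 f2] [g1 g2]; split.
  by under eq_fun do rewrite raddfD /=; rewrite raddfD; exact: cvgD.
by under eq_fun do rewrite raddfD /=; rewrite raddfD; exact: cvgD.
Qed.

Lemma ReM (x y : R[i]) :
  complex.Re (x * y) = complex.Re x * complex.Re y - complex.Im x * complex.Im y.
Proof. by case: x y => [a b] [c d]. Qed.

Lemma ImM (x y : R[i]) :
  complex.Im (x * y) = complex.Re x * complex.Im y + complex.Im x * complex.Re y.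
Proof. by case: x y => [a b] [c d]. Qed.

Lemma ccvgM f g y z : ccvg f y -> ccvg g z -> ccvg (fun t => f t * g t) (y * z).
Proof.
move=> [f1 f2] [g1 g2]; split.
  by under eq_fun do rewrite ReM; rewrite ReM; apply: cvgB; exact: cvgM.
by under eq_fun do rewrite ImM; rewrite ImM; apply: cvgD; exact: cvgM.
Qed.

Lemma ccvg_conj f z : ccvg f z -> ccvg (fun t => (f t)^*) z^*.
Proof.
have ReC (x : R[i]) : complex.Re x^* = complex.Re x by case: x.
have ImC (x : R[i]) : complex.Im x^* = - complex.Im x by case: x.
move=> [f1 f2]; split.
  by under eq_fun do rewrite ReC; rewrite ReC.
by under eq_fun do rewrite ImC; rewrite ImC; exact: cvgN.
Qed.

Lemma ccvg_sum (I : Type) (r : seq I) (P : pred I) (f : I -> T -> R[i]) (z : I -> R[i]) :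
  (forall i, P i -> ccvg (f i) (z i)) ->
  ccvg (fun t => \sum_(i <- r | P i) f i t) (\sum_(i <- r | P i) z i).
Proof.
move=> cf; elim: r => [|i r IH].
  by under eq_fun do rewrite big_nil; rewrite big_nil; exact: ccvg_cst.
under eq_fun do rewrite big_cons; rewrite big_cons; case Pi: (P i) => //.
by apply: ccvgD => //; exact: cf.
Qed.

Lemma cvgr_sum (I : Type) (r : seq I) (f : I -> T -> R) (l : I -> R) :
  (forall i, f i @ F --> l i) ->
  (fun t => \sum_(i <- r) f i t) @ F --> \sum_(i <- r) l i.
Proof.
move=> cf; elim: r => [|i r IH].
  by under eq_fun do rewrite big_nil; rewrite big_nil; exact: cvg_cst.
by under eq_fun do rewrite big_cons; rewrite big_cons; exact: cvgD.
Qed.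

Lemma ccvg_prod (I : Type) (r : seq I) (P : pred I) (f : I -> T -> R[i]) (z : I -> R[i]) :
  (forall i, P i -> ccvg (f i) (z i)) ->
  ccvg (fun t => \prod_(i <- r | P i) f i t) (\prod_(i <- r | P i) z i).
Proof.
move=> cf; elim: r => [|i r IH].
  by under eq_fun do rewrite big_nil; rewrite big_nil; exact: ccvg_cst.
under eq_fun do rewrite big_cons; rewrite big_cons; case Pi: (P i) => //.
by apply: ccvgM => //; exact: cf.
Qed.

Lemma ccvg_normc_sq f z : ccvg f z ->
  (fun t => normc (f t) ^+ 2 : R) @ F --> (normc z ^+ 2 : R).
Proof.
have nE (x : R[i]) : normc x ^+ 2 =
    complex.Re x * complex.Re x + complex.Im x * complex.Im x.
  by case: x => a b /=; rewrite sqr_sqrtr ?addr_ge0 ?sqr_ge0 // -!expr2.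
move=> [f1 f2]; under eq_fun do rewrite nE; rewrite nE.
by apply: cvgD; exact: cvgM.
Qed.

End ComplexLimits.

(** * Continuity in theta, extreme values on the unit square, and an entrywise operator bound *)

Section Continuity.
Variable R : realType.

Definition ccont (f : R * R -> R[i]) := forall t, ccvg (nbhs t) f (f t).

Lemma ccont_cst c : ccont (fun=> c).
Proof. by move=> t; exact: ccvg_cst. Qed.

Lemma ccontM f g : ccont f -> ccont g -> ccont (fun t => f t * g t).
Proof. by move=> cf cg t; apply: ccvgM; [exact: cf|exact: cg]. Qed.

Lemma ccont_expi (f : R * R -> R) : continuous f -> ccont (fun t => expi (f t)).
Proof.
move=> cf t; split=> /=.
  by apply: (@continuous_comp _ _ _ f cos t (cf t)); exact: continuous_cos.
by apply: (@continuous_comp _ _ _ f sin t (cf t)); exact: continuous_sin.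
Qed.

Definition mcont m n (A : R * R -> 'M[R[i]]_(m, n)) := forall i j, ccont (fun t => A t i j).

Lemma mcont_cst m n (A : 'M[R[i]]_(m, n)) : mcont (fun=> A).
Proof. by move=> i j; exact: ccont_cst. Qed.

Lemma mcontD m n (A B : R * R -> 'M[R[i]]_(m, n)) :
  mcont A -> mcont B -> mcont (fun t => A t + B t).
Proof.
move=> cA cB i j; under eq_fun do rewrite mxE.
by move=> t; apply: ccvgD; [exact: cA|exact: cB].
Qed.

Lemma mcontZ m n c (A : R * R -> 'M[R[i]]_(m, n)) :
  ccont c -> mcont A -> mcont (fun t => c t *: A t).
Proof. by move=> cc cA i j; (under eq_fun do rewrite mxE); exact: ccontM. Qed.

Lemma mcont_adj m n (A : R * R -> 'M[R[i]]_(m, n)) :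
  mcont A -> mcont (fun t => (A t) ^t*%sesqui).
Proof. by move=> cA i j; (under eq_fun do rewrite conj_mxE) => t; exact/ccvg_conj/cA. Qed.

Lemma mcont_row m n1 n2 (A : R * R -> 'M[R[i]]_(m, n1)) (B : R * R -> 'M[R[i]]_(m, n2)) :
  mcont A -> mcont B -> mcont (fun t => row_mx (A t) (B t)).
Proof.
move=> cA cB i j; under eq_fun do rewrite mxE.
by case: (fintype.split j) => k; [exact: cA|exact: cB].
Qed.

Lemma mcont_col m1 m2 n (A : R * R -> 'M[R[i]]_(m1, n)) (B : R * R -> 'M[R[i]]_(m2, n)) :
  mcont A -> mcont B -> mcont (fun t => col_mx (A t) (B t)).
Proof.
move=> cA cB i j; under eq_fun do rewrite mxE.
by case: (fintype.split i) => k; [exact: cA|exact: cB].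
Qed.

Lemma ccont_det n (A : R * R -> 'M[R[i]]_n) : mcont A -> ccont (fun t => \det (A t)).
Proof.
move=> cA t; apply: ccvg_sum => s _; apply: ccvgM; first exact: ccvg_cst.
by apply: ccvg_prod => i _; exact: cA.
Qed.

Lemma mcont_adjugate n (A : R * R -> 'M[R[i]]_n) : mcont A -> mcont (fun t => \adj (A t)).
Proof.
move=> cA i j; under eq_fun do rewrite mxE /cofactor.
apply: ccontM; first exact: ccont_cst; apply: ccont_det => k l.
under eq_fun do rewrite !mxE.
exact: cA.
Qed.

Definition square : set (R * R) := `[0, 1]%classic `*` `[0, 1]%classic.

Lemma square_compact : compact square.
Proof. by apply: compact_setX; exact: segment_compact. Qed.

Lemma square_bounded (f : R * R -> R) : continuous f ->
  exists C : R, forall t, square t -> f t <= C.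
Proof.
move=> cf; have s0 : square !=set0.
  by exists (0, 0); split; rewrite /= in_itv /= lexx ler01.
have [c _ cP] := compact_EVT_max s0 square_compact (continuous_subspaceT cf).
by exists (f c) => t st; apply: cP; rewrite inE.
Qed.

Lemma square_bounded_below (f : R * R -> R) : continuous f -> (forall t, square t -> 0 < f t) ->
  exists2 d : R, 0 < d & forall t, square t -> d <= f t.
Proof.
move=> cf f0; have s0 : square !=set0.
  by exists (0, 0); split; rewrite /= in_itv /= lexx ler01.
have [c cs cP] := compact_EVT_min s0 square_compact (continuous_subspaceT cf).
exists (f c); first by apply: f0; rewrite inE in cs.
by move=> t st; apply: cP; rewrite inE.
Qed.

(** A crude bound: each coordinate of A x is a sum of n terms of size at most sqrt(B vsq x), which
    gives n^2 after squaring and n^3 after summing over the coordinates. *)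
Lemma vsq_mulmx n (A : 'M[R[i]]_n) (x : 'cV[R[i]]_n) (B : R) : 0 <= B ->
  (forall i j, normc (A i j) ^+ 2 <= B) ->
  vsq (A *m x) <= n%:R ^+ 3 * B * vsq x.
Proof.
move=> B0 AB.
have nge0 (z : R[i]) : 0 <= normc z by case: z => a b; rewrite sqrtr_ge0.
have sqle (z : R[i]) (c : R) : normc z ^+ 2 <= c -> normc z <= Num.sqrt c.
  move=> zc; rewrite -[normc z]ger0_norm // -sqrtr_sqr ler_sqrt //.
  exact: le_trans (sqr_ge0 _) zc.
have xj j : normc (x j 0) <= Num.sqrt (vsq x).
  by apply: sqle; rewrite /vsq (bigD1 j) //= lerDl sumr_ge0 // => i _; exact: sqr_ge0.
have row i : normc ((A *m x) i 0) ^+ 2 <= n%:R ^+ 2 * B * vsq x.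
  have le1 : normc ((A *m x) i 0) <= n%:R * (Num.sqrt B * Num.sqrt (vsq x)).
    rewrite mxE; apply: (@le_trans _ _ (\sum_(j < n) normc (A i j * x j 0))).
      elim/big_ind2: _ => [|z c w d zc wd|//]; first by rewrite normc0.
      exact: le_trans (le_normcD _ _) (lerD zc wd).
    have -> c : n%:R * c = \sum_(j < n) c :> R by rewrite sumr_const card_ord mulr_natl.
    apply: ler_sum => j _.
    by rewrite normcM; apply: ler_pM => //; exact: sqle.
  have := ler_pM (nge0 _) (nge0 _) le1 le1; rewrite -expr2 => /le_trans; apply.
  by rewrite -expr2 !exprMn !sqr_sqrtr ?vsq_ge0 // mulrA.
apply: (@le_trans _ _ (\sum_(i < n) n%:R ^+ 2 * B * vsq x)); first exact: ler_sum.
by rewrite sumr_const card_ord -[leLHS]mulr_natl [in leRHS]exprS !mulrA.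
Qed.

End Continuity.

Section UniformInverse.
Variables (R : realType) (p q : nat) (omega : R).

Local Notation bloch t := (blochM p q omega t.1 t.2).

Lemma eigenvalue_unitmx n (A : 'M[R[i]]_n) l : eigenvalue A l = (A - l%:M \notin unitmx).
Proof. by rewrite /eigenvalue /eigenspace kermx_eq0 row_free_unit. Qed.

Lemma mcont_blochM : mcont (fun t => bloch t).
Proof.
have c1 : continuous (fun t : R * R => t.1) by move=> t; exact: cvg_fst.
have c2 : continuous (fun t : R * R => t.2) by move=> t; exact: cvg_snd.
have cM (c : R) (f : R * R -> R) : continuous f -> continuous (fun t : R * R => c * f t).
  by move=> cf t; apply: cvgM; [exact: cvg_cst|exact: cf].
have cN (f : R * R -> R) : continuous f -> continuous (fun t : R * R => - f t).
  by move=> cf t; apply: cvgN; exact: cf.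
have c12 : continuous (fun t : R * R => t.1 + t.2).
  by move=> t; apply: cvgD; [exact: c1|exact: c2].
have m13 : mcont (fun t => M13 p q omega t.1 t.2).
  apply: mcontZ; first exact: ccont_cst.
  apply: mcontD; apply: mcontZ; try exact: mcont_cst.
    by apply: ccont_expi; exact: cM.
  apply: ccontM; first exact: ccont_cst.
  by apply: ccont_expi; exact: cM.
have m15 : mcont (fun t => M15 p q omega t.1 t.2).
  apply: mcontZ; first exact: ccont_cst.
  apply: mcontD; apply: mcontZ; try exact: mcont_cst.
    by apply: ccont_expi; exact: cM.
  by apply: ccont_expi; apply: cN; exact: cM.
have m35 : mcont (fun t => M35 p q omega t.1 t.2).
  apply: mcontZ; first exact: ccont_cst.
  apply: mcontD; apply: mcontZ; try exact: mcont_cst.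
    apply: ccontM; first exact: ccont_cst.
    by apply: ccont_expi; apply: cN; exact: cM.
  by apply: ccont_expi; apply: cN; exact: cM.
have m0 := @mcont_cst R q q 0.
apply: mcont_col; apply: mcont_row => //.
- exact: mcont_row.
- by apply: mcont_col; exact: mcont_adj.
- by apply: mcont_col; apply: mcont_row => //; exact: mcont_adj.
Qed.

(** The inverse is the adjugate divided by the determinant. By compactness the determinant stays
    away from 0 and the entries of the adjugate stay bounded over the square. *)
Lemma uniform_inverse (l : R[i]) :
  (forall t, square t -> ~~ eigenvalue (bloch t) l) ->
  exists2 C : R, 0 <= C & forall t, square t -> bloch t - l%:M \in unitmx /\
    forall y : 'cV_(q + (q + q)), vsq y <= C * vsq ((bloch t - l%:M) *m y).
Proof.
move=> noev; pose A t := bloch t - l%:M.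
have uA t : square t -> A t \in unitmx.
  by move=> /noev; rewrite eigenvalue_unitmx negbK.
have cA : mcont A by apply: mcontD; [exact: mcont_blochM|exact: mcont_cst].
have [d d0 dP] : exists2 d : R, 0 < d & forall t, square t -> d <= normc (\det (A t)) ^+ 2.
  apply: square_bounded_below; first by move=> t; exact: ccvg_normc_sq (ccont_det cA _).
  move=> t /uA; rewrite unitmxE unitfE => dA; rewrite exprn_gt0 //.
  rewrite lt_def; apply/andP; split; last by case: (\det _) => a b; rewrite sqrtr_ge0.
  by apply: contra_neq dA => /eq0_normc.
have /choice[D DP] (ij : 'I_(q + (q + q)) * 'I_(q + (q + q))) :
    exists C : R, forall t, square t -> normc ((\adj (A t)) ij.1 ij.2) ^+ 2 <= C.
  by apply: square_bounded; move=> t; exact: ccvg_normc_sq (mcont_adjugate cA _ _ _).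
pose B : R := \sum_ij `|D ij|.
have B0 : 0 <= B by apply: sumr_ge0.
exists ((q + (q + q))%:R ^+ 3 * (B / d)).
  by rewrite mulr_ge0 ?exprn_ge0 // divr_ge0 // ltW.
move=> t st; split=> [|y]; first exact: uA.
rewrite -[y in leLHS](mulKmx (uA _ st)); apply: vsq_mulmx.
  by rewrite divr_ge0 // ltW.
move=> i j; rewrite /invmx (uA _ st) mxE normcM exprMn.
have nV : normc (\det (A t))^-1 ^+ 2 = (normc (\det (A t)) ^+ 2)^-1.
  by rewrite normcV exprVn.
rewrite nV mulrC ler_pM ?sqr_ge0 ?invr_ge0 ?sqr_ge0 //.
  apply: (le_trans (DP (i, j) _ st)); apply: (le_trans (ler_norm _)).
  by rewrite /B (bigD1 (i, j)) //= lerDl sumr_ge0.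
by rewrite lef_pV2 ?posrE ?dP // (lt_le_trans d0) // dP.
Qed.

End UniformInverse.

(** * Limits along an ultrafilter *)

Section UltraLimit.
Variable R : realType.

(** Compactness of the segment gives a cluster point, and a cluster point of an ultrafilter is a
    limit. *)
Lemma ultra_bounded_cvg (U : set_system nat) (x : nat -> R) (B : R) : UltraFilter U ->
  (\forall k \near U, `|x k| <= B) -> exists l : R, x @ U --> l.
Proof.
move=> UU xB; have PU : ProperFilter U by exact: ultra_proper.
have xU : (x @ U) `[- B, B]%classic.
  by apply: filterS xB => k; rewrite /= in_itv /= ler_norml.
have [l [_ lc]] := segment_compact (fmap_proper_filter x PU) xU.
exists l => V Vl; have [//|nV] := in_ultra_setVsetC (x @^-1` V) UU.
by have [y [ny Vy]] := lc (~` V) V nV Vl.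
Qed.

Lemma ultra_bounded_ccvg (U : set_system nat) (x : nat -> R[i]) (B : R) : UltraFilter U ->
  (\forall k \near U, normc (x k) ^+ 2 <= B) -> exists z, ccvg U x z.
Proof.
move=> UU xB; have PU : ProperFilter U by exact: ultra_proper.
have sq_le (a b : R) : a ^+ 2 + b ^+ 2 <= B -> `|a| <= Num.sqrt B.
  move=> ab; rewrite -sqrtr_sqr ler_wsqrtr // (le_trans _ ab) // lerDl sqr_ge0 //.
have nE (y : R[i]) : normc y ^+ 2 = complex.Re y ^+ 2 + complex.Im y ^+ 2.
  by case: y => a b /=; rewrite sqr_sqrtr ?addr_ge0 ?sqr_ge0.
have [a xa] : exists a : R, (fun k => complex.Re (x k)) @ U --> a.
  apply: (@ultra_bounded_cvg _ _ (Num.sqrt B)) => //.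
  by apply: filterS xB => k; rewrite nE; exact: sq_le.
have [b xb] : exists b : R, (fun k => complex.Im (x k)) @ U --> b.
  apply: (@ultra_bounded_cvg _ _ (Num.sqrt B)) => //.
  by apply: filterS xB => k; rewrite nE addrC; exact: sq_le.
by exists (a +i* b)%C; split.
Qed.

Lemma ccvg_near_unique (U : set_system nat) (x : nat -> R[i]) y z : ProperFilter U ->
  ccvg U x y -> (\forall k \near U, x k = z) -> y = z.
Proof.
move=> PU [x1 x2] xz; apply/eqP; rewrite eq_complex; apply/andP; split; apply/eqP.
  have x1' : (fun k => complex.Re (x k)) @ U --> complex.Re z.
    by apply: cvg_near_cst; apply: filterS xz => k /= ->.
  exact: (cvg_unique (@Rhausdorff R) x1 x1').
have x2' : (fun k => complex.Im (x k)) @ U --> complex.Im z.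
  by apply: cvg_near_cst; apply: filterS xz => k /= ->.
exact: (cvg_unique (@Rhausdorff R) x2 x2').
Qed.

End UltraLimit.

Section WeakLimit.
Variables (R : realType) (n q : nat) (q_gt0 : (0 < q)%N).
Local Notation V := (int * int -> 'cV[R[i]]_n).

Lemma box_energy_ge h (v : V) a : box q h a -> vsq (v a) <= box_energy q h v.
Proof.
move=> ah; have [_ _ /(_ a ah) [x _ <-]] := box_point_bij q_gt0 h.
by rewrite /box_energy (bigD1 x) //= lerDl sumr_ge0 // => y _; exact: vsq_ge0.
Qed.

Lemma le_box_energy h h' (v : V) : (h <= h')%N -> box_energy q h v <= box_energy q h' v.
Proof.
move=> hh'; rewrite -!(energy_box q_gt0).
suff le_cutoff a : vsq (cutoff (box q h) v a) <= vsq (cutoff (box q h') v a).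
  by have [] := le_energy le_cutoff (l2_box q_gt0 h' v).
rewrite /cutoff; have [/set_mem ah|_] := boolP (a \in box q h).
  by rewrite mem_set //; exact: (subset_box q_gt0 hh').
by rewrite vsq0 vsq_ge0.
Qed.

(** A single ultrafilter serves all sites and components at once, in place of a diagonal extraction.
    For fixed h the energy is a finite sum, so it passes to the limit, and it is at most B as soon
    as the index k exceeds h. *)
Lemma weak_limit (u : nat -> V) (B : R) : (forall h, box_energy q h (u h) <= B) ->
  exists (U : set_system nat) (w : V), [/\ ProperFilter U, (\oo : set_system nat) `<=` U,
    forall a j, ccvg U (fun k => u k a j 0) (w a j 0) &
    forall h, box_energy q h w <= B].
Proof.
move=> uB; have [U [UU ooU]] := @ultraFilterLemma nat \oo _.
have PU : ProperFilter U by exact: ultra_proper.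
have near_ge h : \forall k \near U, (h <= k)%N by apply: ooU; exact: nbhs_infty_ge.
have /choice[w wP] (aj : (int * int) * 'I_n) : exists z, ccvg U (fun k => u k aj.1 aj.2 0) z.
  apply: (@ultra_bounded_ccvg _ _ _ B) => //.
  have [|h ah] := @finite_box q q_gt0 [set aj.1]; first exact: finite_set1.
  apply: filterS (near_ge h) => k hk.
  apply: (le_trans _ (uB k)); apply: (le_trans _ (le_box_energy _ hk)).
  apply: (le_trans _ (box_energy_ge (u k) (ah aj.1 erefl))).
  by rewrite /vsq (bigD1 aj.2) //= lerDl sumr_ge0 // => j _; exact: sqr_ge0.
exists U, (fun a => \col_j w (a, j)); split=> // [a j|h]; first by rewrite mxE; exact: (wP (a, j)).
have cw : (fun k => box_energy q h (u k)) @ U --> box_energy q h (fun a => \col_j w (a, j)).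
  apply: cvgr_sum => x; apply: cvgr_sum => j; apply: ccvg_normc_sq.
  by rewrite mxE; exact: (wP (_, j)).
apply: cvgr_to_le cw _; apply: filterS (near_ge h) => k hk.
exact: le_trans (le_box_energy _ hk) (uB k).
Qed.

End WeakLimit.

(** * Linearity, pointwise continuity and locality of finite-range operators *)

Section FiniteRangeTheory.
Variables (R : realType) (n : nat).
Local Notation V := (int * int -> 'cV[R[i]]_n).
Variable T : V -> V.
Hypothesis T_range : finite_range T.

Lemma finite_range_linear c u v : T (c *: u + v) = c *: T u + T v.
Proof.
have [s Ts] := T_range; apply/funext => a; rewrite !fctE !Ts scaler_sumr -big_split.
by apply: eq_bigr => x _; rewrite /= mulmxDr scalemxAr.
Qed.

Lemma finite_rangeD u v : T (u + v) = T u + T v.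
Proof. by rewrite -[u in LHS]scale1r finite_range_linear scale1r. Qed.

Lemma finite_rangeZ c u : T (c *: u) = c *: T u.
Proof.
have [s Ts] := T_range; apply/funext => a; rewrite !fctE !Ts scaler_sumr.
by apply: eq_bigr => x _; rewrite /= scalemxAr.
Qed.

Lemma finite_range_sum (I : finType) (u : I -> V) :
  T (fun a => \sum_k u k a) = fun a => \sum_k T (u k) a.
Proof.
have [s Ts] := T_range; apply/funext => a; rewrite Ts.
under [RHS]eq_bigr do rewrite Ts.
by rewrite exchange_big; apply: eq_bigr => x _; rewrite mulmx_sumr.
Qed.

Lemma finite_range_cvg (U : set_system nat) (u : nat -> V) (w : V) : Filter U ->
  (forall a j, ccvg U (fun k => u k a j 0) (w a j 0)) ->
  forall a j, ccvg U (fun k => T (u k) a j 0) (T w a j 0).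
Proof.
move=> FU uw a j; have [s Ts] := T_range.
under eq_fun do rewrite Ts summxE; rewrite Ts summxE.
apply: ccvg_sum => x _; under eq_fun do rewrite mxE; rewrite mxE.
by apply: ccvg_sum => k _; apply: ccvgM => //; exact: ccvg_cst.
Qed.

Lemma finite_range_subZ l : finite_range (fun v => T v - l *: v).
Proof.
have [s Ts] := T_range; exists ((fun=> (- l)%:M, (0, 0)) :: s) => v [a b].
by rewrite big_cons !fctE Ts mul_scalar_mx scaleNr addrC /Defs.shift /= !addr0.
Qed.

Variables (q : nat) (q_gt0 : (0 < q)%N).

Lemma eq_sum_In (I : Type) (W : nmodType) (s : seq I) (f g : I -> W) :
  (forall x, List.In x s -> f x = g x) -> \sum_(x <- s) f x = \sum_(x <- s) g x.
Proof.
elim: s => [|x s IH] fg; first by rewrite !big_nil.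
rewrite !big_cons fg; last by left.
by rewrite IH // => y ys; apply: fg; right.
Qed.

(** Locality in both directions: values inside a box depend only on a slightly larger box, and
    changes made inside a box are felt only in a slightly larger one. *)
Lemma finite_range_local : exists r,
  (forall h u v, (forall a, box q (h + r) a -> u a = v a) ->
     forall a, box q h a -> T u a = T v a) /\
  (forall h u v, (forall a, ~ box q h a -> u a = v a) ->
     forall a, ~ box q (h + r) a -> T u a = T v a).
Proof.
have [s Ts] := T_range.
(* For the second half: if a translate of a lies in the box h, the opposite translation brings it
   back to a, which therefore lies in the enlarged box. *)
pose opp (x : (int * int -> 'M[R[i]]_n) * (int * int)) := (x.1, (- x.2.1, - x.2.2)).
have [r1 hr1] := box_shifts q_gt0 s.
have [r2 hr2] := box_shifts q_gt0 (map opp s).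
exists (r1 + r2)%N; split=> h u v uv a ha; rewrite !Ts; apply: eq_sum_In => x xs;
  rewrite uv //.
  by apply: (subset_box q_gt0 _ (hr1 _ _ ha _ xs)); lia.
move=> bx; apply: ha; have := hr2 _ _ bx _ (List.in_map opp _ _ xs).
rewrite /Defs.shift /= !addrK -surjective_pairing.
by apply: (subset_box q_gt0); lia.
Qed.

End FiniteRangeTheory.

(** * Boundedness in terms of energies *)

Section BoundedEnergy.
Variables (R : realType) (n : nat).
Local Notation V := (int * int -> 'cV[R[i]]_n).

Lemma bounded_energy (T : V -> V) : bounded_operator T ->
  exists2 D, 0 <= D & forall v, l2 v -> l2 (T v) /\ energy (T v) <= D * energy v.
Proof.
move=> [Tl2 _ [C TC]]; exists (C ^+ 2) => [|v v2]; first exact: sqr_ge0.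
split; first exact: Tl2.
have e0 (u : V) := energy_ge0 u.
have nE (u : V) : l2norm u = Num.sqrt (energy u) by [].
have := TC v v2; rewrite !nE => le1.
have := ler_pM (sqrtr_ge0 _) (sqrtr_ge0 _) le1 le1.
by rewrite -!expr2 exprMn !sqr_sqrtr.
Qed.

Lemma bounded_energy_subZ (T : V -> V) l :
  (exists2 D, 0 <= D & forall v, l2 v -> l2 (T v) /\ energy (T v) <= D * energy v) ->
  exists2 D, 0 <= D & forall v, l2 v ->
    l2 (T v - l *: v) /\ energy (T v - l *: v) <= D * energy v.
Proof.
move=> [D D0 TD]; exists ((D + normc (- l) ^+ 2) *+ 2).
  by rewrite mulrn_wge0 // addr_ge0 ?sqr_ge0.
move=> v v2; have [Tv2 TvD] := TD v v2.
have [lv2 lvD] := energyZ (isT : 0 < 1)%N (- l) v2.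
rewrite -scaleNr; have [T2 TE] := energyD Tv2 lv2; split=> //.
by apply: (le_trans TE); rewrite mulrnAl lerMn2r mulrDl lerD.
Qed.

End BoundedEnergy.

(** * Resolvent and spectrum *)

Section Resolvent.
Variables (R : realType) (p q : nat) (q_gt0 : (0 < q)%N) (omega : R) (l : R[i]).
Local Notation V := (int * int -> 'cV[R[i]]_3).
Let gamma : R := 2 * pi * p%:R / q%:R.

Definition Qsub (v : V) : V := Q gamma omega v - l *: v.

Let Qsub_range : finite_range Qsub.
Proof. exact: (finite_range_subZ (Q_finite_range gamma omega) l). Qed.

Let Qsub_bounded : exists2 D, 0 <= D &
  forall v, l2 v -> l2 (Qsub v) /\ energy (Qsub v) <= D * energy v.
Proof. exact: (bounded_energy_subZ l (bounded_energy (Q_bounded gamma omega))). Qed.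

Lemma Qsub_bloch_wave theta1 theta2 y :
  Qsub (bloch_wave q_gt0 theta1 theta2 y) =
  bloch_wave q_gt0 theta1 theta2 ((blochM p q omega theta1 theta2 - l%:M) *m y).
Proof.
rewrite /Qsub Q_bloch_wave mulmxBl mul_scalar_mx [in RHS]addrC -[in RHS]scaleNr.
by rewrite bloch_wave_linear scaleNr addrC.
Qed.

Lemma Qsub_synthesis h Z : Qsub (synthesis q_gt0 Z) =
  synthesis q_gt0 (fun k => (blochM p q omega (grid1 R q (h := h) k) (grid2 R k) - l%:M) *m Z k).
Proof.
rewrite /synthesis (finite_range_sum Qsub_range); apply/funext => a.
by apply: eq_bigr => k _; rewrite Qsub_bloch_wave.
Qed.

Variable C : R.
Hypothesis C_ge0 : 0 <= C.
Hypothesis C_inverse : forall t, square t ->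
  blochM p q omega t.1 t.2 - l%:M \in unitmx /\
  forall y, vsq y <= C * vsq ((blochM p q omega t.1 t.2 - l%:M) *m y).

Let gridM h (k : 'I_(h.*2.+1) * 'I_(h.*2.+1)) := blochM p q omega (grid1 R q k) (grid2 R k) - l%:M.

Let grid_inverse h (k : 'I_(h.*2.+1) * 'I_(h.*2.+1)) : gridM k \in unitmx /\
  forall y, vsq y <= C * vsq (gridM k *m y).
Proof.
have sk : square (grid1 R q k, grid2 R k).
  by split; rewrite /= in_itv /=; [exact: (grid1_itv R q_gt0 k)|exact: (grid2_itv R q_gt0 k)].
exact: C_inverse sk.
Qed.

(** The equation is solved mode by mode by inverting the Bloch matrix on each Fourier coefficient of
    f cut off to the box. Bloch waves live on all of Z^2, so no boundary condition arises, but u is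
    controlled only on the box. *)
Lemma Qsub_solve_box h (f : V) : l2 f -> exists u : V,
  (forall a, box q h a -> Qsub u a = f a) /\ box_energy q h u <= C * energy f.
Proof.
move=> f2; set g := cutoff (box q h) f.
have g0 b : ~ box q h b -> g b = 0 by move=> hb; rewrite /g /cutoff memNset.
have gE : box_energy q h g = box_energy q h f.
  apply: eq_bigr => x _; rewrite /g /cutoff mem_set //.
  by have [+ _ _] := box_point_bij q_gt0 h; apply.
pose W := analysis q (h := h) g; pose Z k := invmx (gridM k) *m W k.
have NN : (h.*2.+1 ^ 2)%:R != 0 :> R by rewrite natrX expf_neq0 ?pnatr_eq0.
have NNC : (h.*2.+1 ^ 2)%:R != 0 :> R[i] by rewrite natrX expf_neq0 ?pnatr_eq0.
exists ((h.*2.+1 ^ 2)%:R^-1 *: synthesis q_gt0 Z); split.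
  move=> a ah; rewrite (finite_rangeZ Qsub_range) Qsub_synthesis fctE.
  have -> : (fun k => gridM k *m Z k) = W.
    by apply/funext => k; rewrite /Z mulKVmx //; have [] := grid_inverse k.
  rewrite (synthesis_analysis q_gt0 (leqnn h) _ g0 ah); last by lia.
  by rewrite scalerA mulVf // scale1r /g /cutoff mem_set.
apply: (@le_trans _ _ (C * box_energy q h f)); last first.
  by rewrite ler_wpM2l //; exact: box_energy_le.
have -> : box_energy q h ((h.*2.+1 ^ 2)%:R^-1 *: synthesis q_gt0 Z) =
    (h.*2.+1 ^ 2)%:R^-1 ^+ 2 * box_energy q h (synthesis q_gt0 Z).
  rewrite /box_energy mulr_sumr; apply: eq_bigr => x _.
  by rewrite fctE vsqZ normcV normc_nat.
(* The normalisation gives N^(-4) and the synthesis N^2; the energy of the Fourier coefficients of g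
   supplies the remaining N^2. *)
rewrite synthesis_energy mulrA expr2 mulfVK // ler_pdivrMl ?lt_def ?NN ?ler0n //.
rewrite mulrCA -gE -(analysis_energy q_gt0 (leqnn h) g0) mulr_sumr.
apply: ler_sum => k _; have [uk kC] := grid_inverse k.
by apply: (le_trans (kC _)); rewrite /Z mulKVmx.
Qed.

Lemma Qsub_lower_bound n (f : V) : (forall b, ~ box q n b -> f b = 0) -> l2 f ->
  energy f <= C * energy (Qsub f).
Proof.
move=> f0 f2; have [r [loc _]] := finite_range_local Qsub_range q_gt0.
have [D D0 QD] := Qsub_bounded; have [Qf2 _] := QD f f2.
(* The synthesis must reproduce f on the box h + r for [Qsub] to be known on the box h. This
   requires n + (h + r) < 2 h + 1, and h = n + r is the least such value. *)
pose h := (n + r)%N; have nh : (n <= h)%N by rewrite /h; lia.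
pose W := analysis q (h := h) f.
have NN : (h.*2.+1 ^ 2)%:R != 0 :> R by rewrite natrX expf_neq0 ?pnatr_eq0.
have NNC : (h.*2.+1 ^ 2)%:R != 0 :> R[i] by rewrite natrX expf_neq0 ?pnatr_eq0.
have fE : energy f = box_energy q h f.
  rewrite -(energy_box q_gt0); congr energy; apply/funext => b; rewrite /cutoff.
  have [/set_mem //|/negP bh] := boolP (b \in box q h).
  by apply: f0 => bn; apply: bh; rewrite inE; exact: (subset_box q_gt0 nh).
have Wf a : box q (h + r) a -> synthesis q_gt0 W a = ((h.*2.+1 ^ 2)%:R *: f) a.
  by move=> ar; rewrite (synthesis_analysis q_gt0 nh _ f0 ar) // /h; lia.
have QW : box_energy q h (Qsub (synthesis q_gt0 W)) =
    (h.*2.+1 ^ 2)%:R ^+ 2 * box_energy q h (Qsub f).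
  rewrite /box_energy mulr_sumr; apply: eq_bigr => x _.
  rewrite (loc h _ _ Wf); last by have [+ _ _] := box_point_bij q_gt0 h; apply.
  by rewrite (finite_rangeZ Qsub_range) fctE vsqZ normc_nat.
apply: (@le_trans _ _ (C * box_energy q h (Qsub f))); last first.
  by rewrite ler_wpM2l //; exact: box_energy_le.
have N2 : 0 < (h.*2.+1 ^ 2)%:R ^+ 2 :> R by rewrite exprn_gt0 // lt_def NN ler0n.
rewrite -(ler_pM2l N2) mulrCA -QW Qsub_synthesis synthesis_energy fE.
rewrite expr2 -mulrA -(analysis_energy q_gt0 nh f0) mulrCA ler_wpM2l ?ler0n // mulr_sumr.
by apply: ler_sum => k _; have [_] := grid_inverse k; apply.
Qed.

(** Split v into u inside a box and w outside. Then [Qsub u] is minus [Qsub w], and the lower bound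
    for u gives energy u at most C D energy w = C D (energy v - energy u). So every box holds at
    most the fraction C D / (1 + C D) < 1 of the energy of v, which forces that energy to be 0. *)
Lemma Qsub_injective (v : V) : l2 v -> Qsub v = 0 -> v = 0.
Proof.
move=> v2 Qv; have [D D0 QD] := Qsub_bounded.
apply: energy_eq0 => //; apply/eqP; rewrite eq_le energy_ge0 andbT.
have E0 := energy_ge0 v.
have le_h h : box_energy q h v <= C * D / (1 + C * D) * energy v.
  pose u := cutoff (box q h) v; pose w := cutoff (~` box q h) v.
  have u2 : l2 u by exact: l2_cutoff.
  have w2 : l2 w by exact: l2_cutoff.
  have uw : u + w = v.
    apply/funext => a; rewrite fctE /u /w /cutoff in_setC.
    by case: (a \in _); rewrite /= ?addr0 ?add0r.
  have Quw : Qsub u = (-1) *: Qsub w.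
    apply/eqP; rewrite scaleN1r -addr_eq0 -(finite_rangeD Qsub_range) uw Qv.
    exact/eqP.
  have u0 b : ~ box q h b -> u b = 0 by move=> hb; rewrite /u /cutoff memNset.
  have le1 := Qsub_lower_bound u0 u2.
  have [Qw2 QwD] := QD w w2.
  have [_ le2] := energyZ q_gt0 (-1) Qw2.
  have n1 : normc (-1 : R[i]) = 1.
    by rewrite /normc /= oppr0 expr0n addr0 sqrrN expr1n sqrtr1.
  rewrite n1 expr1n mul1r -Quw in le2.
  have le3 : energy u <= C * D * energy w.
    rewrite -mulrA; exact: le_trans le1 (ler_wpM2l C_ge0 (le_trans le2 QwD)).
  have Ev := energy_cutoffC (box q h) v2; rewrite -/u -/w in Ev.
  rewrite -(energy_box q_gt0) -/u; clearbody u w.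
  have CD0 : 0 <= C * D by exact: mulr_ge0.
  rewrite mulrAC ler_pdivlMr; last by rewrite ltr_pwDl.
  rewrite Ev; move: (energy u) (energy w) le3 => eu ew; lra.
have := energy_le (sqnorm_le_box q_gt0 le_h); move=> [_].
have CD0 : 0 <= C * D by exact: mulr_ge0.
rewrite mulrAC ler_pdivlMr; last by rewrite ltr_pwDl.
by move: (energy v) E0 => E E0; lra.
Qed.

(** A weak limit of the box solutions. At a given site the equation holds exactly for all large
    boxes and involves finitely many values, so it survives in the limit. *)
Lemma Qsub_solve (f : V) : l2 f ->
  exists u, [/\ l2 u, Qsub u = f & energy u <= C * energy f].
Proof.
move=> f2; have /choice[u uP] := fun h => Qsub_solve_box h f2.
have [U [w [PU ooU uw wB]]] := weak_limit q_gt0 (fun h => proj2 (uP h)).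
exists w; have [w2 wE] := energy_le (sqnorm_le_box q_gt0 wB); split=> //.
apply/funext => a; apply/colP => j.
apply: (ccvg_near_unique PU (finite_range_cvg Qsub_range _ uw a j)).
have [|h ah] := @finite_box q q_gt0 [set a]; first exact: finite_set1.
have : \forall k \near U, (h <= k)%N by apply: ooU; exact: nbhs_infty_ge.
apply: filterS => k hk; rewrite (proj1 (uP k)) //.
by apply: (subset_box q_gt0 hk); exact: ah.
Qed.

(** The resolvent picks a solution for each f; injectivity makes this choice linear and a left
    inverse as well. *)
Lemma resolvent_set_Q : resolvent_set (Q gamma omega) l.
Proof.
have /choice[S SP] (f : V) : exists u, l2 f ->
    [/\ l2 u, Qsub u = f & energy u <= C * energy f].
  have [f2|nf2] := pselect (l2 f); last by exists 0.
  by have [u uP] := Qsub_solve f2; exists u.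
have inj (u v : V) : l2 u -> l2 v -> Qsub u = Qsub v -> u = v.
  move=> u2 v2 Quv; apply/eqP; rewrite -subr_eq0; apply/eqP.
  have [v2' _] := energyZ q_gt0 (-1) v2.
  apply: Qsub_injective; rewrite -scaleN1r; first by have [] := energyD u2 v2'.
  by rewrite (finite_rangeD Qsub_range) (finite_rangeZ Qsub_range) scaleN1r Quv subrr.
have [D D0 QD] := Qsub_bounded.
exists S; split; last first.
  move=> v v2; have [Qv2 _] := QD v v2; have [Sv2 QS _] := SP v v2.
  have [SQ2 QSQ _] := SP _ Qv2.
  by split; [exact: inj|exact: QS].
split.
- by move=> v /SP[].
- move=> c u v u2 v2; have [Su2 QSu _] := SP u u2; have [Sv2 QSv _] := SP v v2.
  have [cu2 _] := energyZ q_gt0 c u2; have [cuv2 _] := energyD cu2 v2.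
  have [cSu2 _] := energyZ q_gt0 c Su2; have [cSuv2 _] := energyD cSu2 Sv2.
  have [Scuv2 QScuv _] := SP _ cuv2.
  apply: inj => //.
  by rewrite QScuv (finite_range_linear Qsub_range) QSu QSv.
- exists (Num.sqrt C) => v v2; have [_ _ SE] := SP v v2.
  by rewrite -[l2norm v]/(Num.sqrt (energy v)) -sqrtrM // ler_wsqrtr.
Qed.

End Resolvent.

(** [eigenvalue] refers to row vectors, while Bloch waves are built from columns; invertibility is
    unchanged by transposition. *)
Lemma eigenvalue_column (R : realType) n (A : 'M[R[i]]_n) l : eigenvalue A l ->
  exists2 y : 'cV_n, y != 0 & (A - l%:M) *m y = 0.
Proof.
rewrite eigenvalue_unitmx -unitmx_tr -row_free_unit -kermx_eq0 => kA.
exists (nz_row (kermx (A - l%:M)^T))^T.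
  by rewrite -trmx0 (inj_eq trmx_inj) nz_row_eq0.
apply: trmx_inj; rewrite trmx_mul trmxK trmx0.
by apply/sub_kermxP; exact: nz_row_sub.
Qed.

(** * Truncated Bloch waves and the spectrum *)

Section Spectrum.
Variables (R : realType) (p q : nat) (q_gt0 : (0 < q)%N) (omega theta1 theta2 : R).
Let gamma : R := 2 * pi * p%:R / q%:R.

(** The phase has modulus 1 and the box contains each residue (2 h + 1)^2 times. *)
Lemma box_energy_bloch_wave h y :
  box_energy q h (bloch_wave q_gt0 theta1 theta2 y) = (h.*2.+1 ^ 2)%:R * vsq y.
Proof.
rewrite /box_energy (eq_bigr (fun x : box_index q h =>
  (fun (j : 'I_q) (m : 'I_(h.*2.+1) * 'I_(h.*2.+1)) =>
    \sum_i normc (block y i j 0) ^+ 2) x.1 x.2)); last first.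
  move=> x _; apply: eq_bigr => i _.
  by rewrite mxE /wave residue_box_point normcM normc_expi mul1r.
rewrite -(pair_bigA _ (fun (j : 'I_q) (m : 'I_(h.*2.+1) * 'I_(h.*2.+1)) =>
    \sum_i normc (block y i j 0) ^+ 2)) /=.
under eq_bigr do rewrite sumr_const card_prod card_ord mulnn.
by rewrite sumrMnl exchange_big /= vsq_block mulr_natl.
Qed.

Lemma eigenvalue_spectrum l : eigenvalue (blochM p q omega theta1 theta2) l ->
  spectrum (Q gamma omega) l.
Proof.
move=> /eigenvalue_column[y y0 My] [S [bS SQ]].
pose A := Qsub p q omega l.
have A_range : finite_range A by exact: (finite_range_subZ (Q_finite_range gamma omega) l).
have [D D0 AD] : exists2 D, 0 <= D &
    forall v, l2 v -> l2 (A v) /\ energy (A v) <= D * energy v.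
  exact: (bounded_energy_subZ l (bounded_energy (Q_bounded gamma omega))).
have [C C0 SC] := bounded_energy bS.
have [r [loc loc']] := finite_range_local A_range q_gt0.
set u := bloch_wave q_gt0 theta1 theta2 y.
have Au : A u = 0.
  rewrite /A /u Qsub_bloch_wave My; apply/funext => a; apply/colP => i.
  by rewrite !mxE /wave !mxE mulr0.
have A0 : A 0 = 0 by have := finite_rangeZ A_range 0 0; rewrite !scale0r.
have Y0 : 0 < vsq y.
  by rewrite lt_def vsq_ge0 andbT; apply: contra_neq y0; exact: vsq_eq0.
(* Here v is the wave cut off to the box h + 2 r, and w is v without the box h. On the box h + r, v
   gives the same [A] as u, namely 0; outside it, v gives the same [A] as w. So [A v] is dominated
   by [A w], and inverting by S bounds the energy of v by that of the boundary layer w. *)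
have key h : box_energy q (h + r + r) u <=
    C * D * (box_energy q (h + r + r) u - box_energy q h u).
  pose v := cutoff (box q (h + r + r)) u; pose w := cutoff (~` box q h) v.
  have v2 : l2 v by exact: l2_box.
  have w2 : l2 w by exact: l2_cutoff.
  have [Av2 _] := AD v v2; have [Aw2 AwD] := AD w w2.
  have Avw a : vsq (A v a) <= vsq (A w a).
    have [ah|ah] := pselect (box q (h + r) a).
      rewrite (loc _ v u _ a ah) ?Au ?vsq0 ?vsq_ge0 // => b bh.
      by rewrite /v /cutoff mem_set.
    rewrite (loc' h v w _ a ah) // => b bh.
    by rewrite /w /cutoff mem_set.
  have [_ AvAw] := le_energy Avw Aw2.
  have [SAv _] := SQ v v2; have [_ SAvC] := SC _ Av2.
  have wE : energy v = energy w + box_energy q h u.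
    rewrite (energy_cutoffC (box q h) v2) addrC; congr (_ + _).
    rewrite -(energy_box q_gt0); congr energy; apply/funext => a.
    rewrite /v /cutoff; have [/set_mem ah|//] := boolP (a \in box q h).
    by rewrite mem_set //; apply: (subset_box q_gt0 _ ah); lia.
  have vE : energy v = box_energy q (h + r + r) u by exact: energy_box.
  have le1 : energy v <= C * energy (A v) by rewrite -[X in energy X <= _]SAv.
  have le2 : energy v <= C * D * energy w.
    rewrite -mulrA; exact: le_trans le1 (ler_wpM2l C0 (le_trans AvAw AwD)).
  by rewrite -vE; clearbody v w; rewrite [X in _ * (X - _)]wE addrK.
(* With N = 2 (h + 2 r) + 1 and n = 2 h + 1 = N - 4 r, the estimate reads N^2 <= C D (N^2 - n^2),
   and N^2 - n^2 = 4 r (N + n) <= 8 r N. So N would be bounded independently of h. *)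
have {key}key h : ((h + r + r).*2.+1%:R : R) <= 8 * r%:R * (C * D).
  have := key h; rewrite /u !box_energy_bloch_wave.
  rewrite -mulrBl [X in _ <= X -> _]mulrA ler_pM2r // !natrX.
  set N := (h + r + r).*2.+1%:R; set n := h.*2.+1%:R.
  have nE : n = N - 4 * r%:R.
    by rewrite /n /N -!addnn -!natr1 !natrD; ring.
  have r0 : 0 <= r%:R :> R by exact: ler0n.
  have n0 : 0 <= n by exact: ler0n.
  have N0 : 0 < N by rewrite ltr0n.
  have CD0 : 0 <= C * D by exact: mulr_ge0.
  move=> le1; rewrite -(ler_pM2r N0) -expr2; apply: (le_trans le1).
  have -> : N ^+ 2 - n ^+ 2 = 4 * r%:R * (N + n) by rewrite nE; ring.
  have -> : 8 * r%:R * (C * D) * N = C * D * (4 * r%:R * (N + N)) by ring.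
  by rewrite !ler_wpM2l ?mulr_ge0 // lerD2l nE lerBlDr lerDl mulr_ge0.
pose K := 8 * r%:R * (C * D).
have K0 : 0 <= K by rewrite !mulr_ge0.
have := key (Num.bound K).
have lt1 : K < (Num.bound K)%:R by exact: archi_boundP.
rewrite -/K leNgt => /negP; apply; apply: (lt_le_trans lt1).
by rewrite ler_nat; lia.
Qed.

End Spectrum.

Theorem theorem1p9 (R : realType) (omega gamma : R) (p q : nat)
    (p_gt0 : (0 < p)%N) (q_gt0 : (0 < q)%N) (cop : coprime p q)
    (gammaE : gamma = 2 * pi * p%:R / q%:R) :
  spectrum (Q gamma omega) =
  \bigcup_(theta1 in `[0, 1]) \bigcup_(theta2 in `[0, 1])
    [set lambda | eigenvalue (blochM p q omega theta1 theta2) lambda].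
Proof.
rewrite gammaE; apply/seteqP; split=> [l sl|l [t1 _ [t2 _ ev]]]; last first.
  exact: (eigenvalue_spectrum q_gt0 ev).
apply: contrapT => nev; apply: sl.
have [t [t1 t2]|C C0 CP] := @uniform_inverse R p q omega l.
  by apply/negP => ev; apply: nev; exists t.1 => //; exists t.2.
exact: (resolvent_set_Q q_gt0 C0 CP).
Qed.
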